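(* Every Abelian periodic group variety (considered as a semigroup variety) is definable.
   Context: $\mathbf{SEM}$ denotes the lattice of all semigroup varieties, ordered by inclusion, with join $\vee$ and meet $\wedge$. A single semigroup variety $\mathcal X$ is called definable if there is a first-order formula $\Phi(x)$ with one free variable $x$ (and no parameters) in the language of the lattice operations $\vee$ and $\wedge$ such that, for every $\mathcal V\in\mathbf{SEM}$, the sentence $\Phi(\mathcal V)$ is true in $\mathbf{SEM}$ if and only if $\mathcal V=\mathcal X$. An Abelian periodic group variety is a semigroup variety all of whose members are periodic Abelian groups. *)

(* Defs.v *)
From HB Require Import structures.
From mathcomp Require Import all_boot all_order.
From mathcomp Require Import boolp classical_sets.

Set Implicit Arguments.
Unset Strict Implicit.
Unset Printing Implicit Defensive.

Import Order.TTheory.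

Local Open Scope classical_set_scope.
Local Open Scope order_scope.

(* Stated directly rather than through semigroupType: the carriers of all
   MathComp structures share one universe, so a class of semigroupTypes would be
   too large to be an element of a latticeType. *)
Record semigroup : Type := MkSemigroup {
  sg_sort :> Type;
  sg_mul : sg_sort -> sg_sort -> sg_sort;
  sg_mulA : associative sg_mul;
  sg_inhabited : inhabited sg_sort }.

(* The pair (i, s) is the nonempty word x_i x_(s_0) ... x_(s_(k-1)) of the
   free semigroup over the countable alphabet {x_j | j : nat}. *)
Definition word : Type := nat * seq nat.

Definition word_eval (S : semigroup) (a : nat -> S) (w : word) : S :=
  foldl (fun x j => sg_mul x (a j)) (a w.1) w.2.

Definition identity : Type := word * word.

Definition satisfies (S : semigroup) (e : identity) : Prop :=
  forall a : nat -> S, word_eval a e.1 = word_eval a e.2.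

Definition models (Sigma : set identity) : set semigroup :=
  [set S | forall e, Sigma e -> satisfies S e].

Definition is_variety (K : set semigroup) : Prop :=
  exists Sigma : set identity, K = models Sigma.

Definition theory (K : set semigroup) : set identity :=
  [set e | forall S, K S -> satisfies S e].

Record SEM : Type := Variety {
  members :> set semigroup;
  members_variety : `[< is_variety members >] }.

HB.instance Definition _ := [isSub for members].
HB.instance Definition _ := [Choice of SEM by <:].

Lemma SEM_models (V : SEM) : exists Sigma, members V = models Sigma.
Proof. by case: V => K KV; apply/asboolP. Qed.

Lemma is_varietyI (V W : SEM) : `[< is_variety (V `&` W)%classic >].
Proof.
have [A VA] := SEM_models V; have [B WB] := SEM_models W.
apply/asboolP; exists (A `|` B)%classic; rewrite VA WB.
apply/seteqP; split => S.
- by move=> [SA SB] e [/SA|/SB].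
- by move=> SAB; split=> e He; apply: SAB; [left|right].
Qed.

Lemma is_varietyU (V W : SEM) :
  `[< is_variety (models (theory (V `|` W)%classic)) >].
Proof. by apply/asboolP; exists (theory (V `|` W)%classic). Qed.

Definition sem_le (V W : SEM) : bool := `[< V `<=` W >].
Definition sem_meet (V W : SEM) : SEM := Variety (is_varietyI V W).
Definition sem_join (V W : SEM) : SEM := Variety (is_varietyU V W).

Lemma sem_le_refl : reflexive sem_le.
Proof. by move=> V; apply/asboolP. Qed.

Lemma sem_le_anti : antisymmetric sem_le.
Proof.
move=> V W /andP[/asboolP VW /asboolP WV].
by apply: val_inj; apply/seteqP.
Qed.

Lemma sem_le_trans : transitive sem_le.
Proof.
move=> W V U /asboolP VW /asboolP WU; apply/asboolP.
exact: subset_trans WU.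
Qed.

Fact sem_display : Order.disp_t. Proof. exact: Order.Disp tt tt. Qed.

HB.instance Definition _ := Order.Le_isPOrder.Build sem_display SEM
  sem_le_refl sem_le_anti sem_le_trans.

Lemma sem_meetP (U V W : SEM) : (U <= sem_meet V W) = (U <= V) && (U <= W).
Proof.
apply/asboolP/andP => [H|[/asboolP UV /asboolP UW] S US].
  by split; apply/asboolP => S /H[].
by split; [exact: UV | exact: UW].
Qed.

Lemma sem_joinP (V W U : SEM) : (sem_join V W <= U) = (V <= U) && (W <= U).
Proof.
apply/asboolP/andP => [H|[/asboolP VU /asboolP WU]].
  by split; apply/asboolP => S TS; apply: H => e; apply; [left|right].
have [A UA] := SEM_models U; rewrite UA in VU WU * => S SVW e Ae.
by apply: SVW => T [/VU|/WU]; apply.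
Qed.

HB.instance Definition _ := Order.POrder_MeetJoin_isLattice.Build
  sem_display SEM sem_meetP sem_joinP.

Inductive lterm : Type :=
| LVar of nat
| LJoin of lterm & lterm
| LMeet of lterm & lterm.

Inductive lformula : Type :=
| FEq of lterm & lterm
| FNot of lformula
| FAnd of lformula & lformula
| FOr of lformula & lformula
| FImp of lformula & lformula
| FForall of nat & lformula
| FExists of nat & lformula.

Fixpoint lterm_vars (t : lterm) : seq nat :=
  match t with
  | LVar i => [:: i]
  | LJoin t1 t2 | LMeet t1 t2 => lterm_vars t1 ++ lterm_vars t2
  end.

Fixpoint free_vars (f : lformula) : seq nat :=
  match f with
  | FEq t1 t2 => lterm_vars t1 ++ lterm_vars t2
  | FNot g => free_vars g
  | FAnd g h | FOr g h | FImp g h => free_vars g ++ free_vars h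
  | FForall i g | FExists i g => [seq j <- free_vars g | j != i]
  end.

Section Satisfaction.
Variables (d : Order.disp_t) (L : latticeType d).
Implicit Type e : nat -> L.

Fixpoint lterm_eval e (t : lterm) : L :=
  match t with
  | LVar i => e i
  | LJoin t1 t2 => lterm_eval e t1 `|` lterm_eval e t2
  | LMeet t1 t2 => lterm_eval e t1 `&` lterm_eval e t2
  end.

Definition update e (i : nat) (a : L) : nat -> L :=
  fun j => if j == i then a else e j.

Fixpoint holds e (f : lformula) : Prop :=
  match f with
  | FEq t1 t2 => lterm_eval e t1 = lterm_eval e t2
  | FNot g => ~ holds e g
  | FAnd g h => holds e g /\ holds e h
  | FOr g h => holds e g \/ holds e h
  | FImp g h => holds e g -> holds e h
  | FForall i g => forall a : L, holds (update e i a) g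
  | FExists i g => exists a : L, holds (update e i a) g
  end.

Definition definable (a : L) : Prop :=
  exists (Phi : lformula) (i : nat), free_vars Phi =i pred1 i /\
    forall e, holds e Phi <-> e i = a.

End Satisfaction.

(* Being a group is a property of a semigroup: it is isomorphic to the
   multiplicative semigroup of a group. *)
Definition periodic_abelian_group (S : semigroup) : Prop :=
  exists (G : groupType) (f : G -> S),
    [/\ bijective f,
        {morph f : x y / (x * y)%g >-> sg_mul x y},
        (forall x y : G, x * y = y * x)%g &
        forall x : G, exists2 n : nat, (0 < n)%N & (x ^+ n = 1)%g].

Definition abelian_periodic_group_variety (V : SEM) : Prop :=
  forall S : semigroup, members V S -> periodic_abelian_group S.

(* Main.v *)
Require Import Defs.
From HB Require Import structures.
From mathcomp Require Import all_boot all_order all_algebra zify.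
From mathcomp Require Import boolp classical_sets.

(** The lattice of varieties of abelian groups of finite exponent is the
    divisibility lattice, whose automorphisms permute the primes; so the exponent
    must be recovered from the interaction of these varieties with others, here
    the commutative nil varieties.

    The variety COM of commutative semigroups is the join of the varieties
    ABEL p of abelian groups of prime exponent p.  Each ABEL p is the only atom
    below the larger variety ABEL (p^2); and an atom with such an extension is
    always commutative, because every nontrivial variety contains null semigroups
    (ZM), semilattices (SL), some ABEL p, left zero or right zero semigroups, and
    a variety with none of the first three consists of rectangular bands.  Hence
    COM is the least upper bound of the extensible atoms (COM_char).  Below COM,
    SL is the atom without extension (SL_char), and ZM is the one that is the
    only atom of a variety whose subvarieties are not linearly ordered
    (ZM_char).  This defines the commutative nil varieties (nil_varietyP) and the
    varieties of abelian groups (group_varietyP), which are the ABEL n.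

    To find n, compare the joins of group varieties with a nil variety W in which
    all products of k + 1 factors vanish.  The identities of ABEL n and W
    together are those of W that balance each letter modulo n.  For n >= k - 1
    such an identity is trivial or has zero sides (zero_of_congruent), and then
    the nil varieties contained in the join of ABEL n and W include those
    contained in the join of any group variety and W (detects_large).  For
    n <= k - 2 the identity x^(k-1) y = x^(k-1-n) y^(1+n) between nonzero words
    makes the nil part of the join smaller, for a suitable W (detects_small).
    So n is the number that passes the test for k = n + 1 and fails it for
    k = n + 2.

    The nilpotency class of W is also visible in the lattice.  A nil variety in
    which x_0 ... x_k is not zero contains the variety NILPOTENT2 (k+2) given by
    x^2 = 0 and x_0 ... x_(k+1) = 0 (NILPOTENT2_min).  The subvarieties of the
    latter form a chain with k + 2 members (chain_NILPOTENT2), and for k > 2 no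
    other nil variety has this property (chain_square). *)

Set Implicit Arguments.
Unset Strict Implicit.
Unset Printing Implicit Defensive.
Import Order.TTheory GRing.Theory.


(** * Words in commutative semigroups *)

Definition letters (w : word) : seq nat := w.1 :: w.2.

Definition occ (i : nat) (w : word) : nat := count_mem i (letters w).

(** The monoid S^1, in additive notation: the outer unit is None.  A word
    evaluates in it to an ordinary finite sum of letters, so that sums over
    letters, multiplicities and multiples apply.  The commutativity proof is an
    argument of the type so that the instance can be found. *)
Definition adj (S : semigroup) (cS : commutative (@sg_mul S)) : Type := option S.

Section Adjoin.
Variables (S : semigroup) (cS : commutative (@sg_mul S)).

HB.instance Definition _ := gen_eqMixin (adj cS).
HB.instance Definition _ := gen_choiceMixin (adj cS).

Definition adj_add (x y : adj cS) : adj cS :=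
  match x, y with
  | Some s, Some t => Some (sg_mul s t)
  | None, _ => y
  | _, None => x
  end.

Lemma adj_addA : associative adj_add.
Proof. by case=> [x|] [y|] [z|] //=; rewrite sg_mulA. Qed.

Lemma adj_addC : commutative adj_add.
Proof. by case=> [x|] [y|] //=; rewrite cS. Qed.

Lemma adj_add0 : left_id None adj_add.
Proof. by case. Qed.

HB.instance Definition _ :=
  GRing.isNmodule.Build (adj cS) adj_addA adj_addC adj_add0.

Definition inj (x : S) : adj cS := Some x.

Lemma injM x y : inj (sg_mul x y) = (inj x + inj y)%R.
Proof. by []. Qed.

Lemma inj_inj : injective inj.
Proof. by move=> x y []. Qed.

Lemma inj_eval (a : nat -> S) w :
  inj (word_eval a w) = (\sum_(i <- letters w) inj (a i))%R.
Proof.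
case: w => i s; rewrite /word_eval /letters /= big_cons.
elim: s (a i) => [|j s IH] x /=; first by rewrite big_nil addr0.
by rewrite IH injM big_cons addrA.
Qed.
End Adjoin.

(** * Varieties given by identities *)

Lemma members_variety_of (Sigma : set identity) :
  `[< is_variety (models Sigma) >].
Proof. by apply/asboolP; exists Sigma. Qed.
Definition variety_of Sigma : SEM := Variety (members_variety_of Sigma).

Lemma le_members V W : (V <= W)%O <-> (forall S, members V S -> members W S).
Proof. by split=> [/asboolP|H]; [|apply/asboolP]. Qed.

(** Inclusion of varieties is reverse inclusion of theories; nearly every
    inclusion below is proved by comparing identities. *)
Lemma le_theory (V W : SEM) :
  (V <= W)%O <-> (forall e, theory (members W) e -> theory (members V) e).
Proof.
split=> [/le_members VW e We S /VW|H]; first exact: We.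
apply/le_members => S VS; have [Sigma WE] := SEM_models W.
rewrite WE => e Se; apply: (H e) => // T; rewrite WE; exact.
Qed.

Lemma eval_wmap (S : semigroup) (a : nat -> S) f w :
  word_eval a (f w.1, map f w.2) = word_eval (a \o f) w.
Proof.
case: w => i s; rewrite /word_eval /=.
by elim: s (a (f i)) => //= j s IH x.
Qed.

(** The word x^t, meaningful for positive t. *)
Definition power (t : nat) : word := (0, nseq t.-1 0).
(** The word x_0 x_1 ... x_(k-1), meaningful for positive k. *)
Definition linear (k : nat) : word := (0, iota 1 k.-1).

Lemma letters_power t : 0 < t -> letters (power t) = nseq t 0.
Proof. by case: t. Qed.

Lemma letters_linear k : 0 < k -> letters (linear k) = iota 0 k.
Proof. by case: k. Qed.

Definition null_elt (S : semigroup) (s : S) := forall y, sg_mul s y = s.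

Definition zero_in (V : SEM) (w : word) : Prop :=
  forall S, members V S -> forall a : nat -> S, null_elt (word_eval a w).

(** The identity w y = w, with y a letter that does not occur in w: in a
    commutative semigroup it says that every value of w is a zero. *)
Definition null_id (w : word) : identity :=
  (w, (w.1, rcons w.2 (\max_(i <- letters w) i).+1)).

Lemma eval_eq_in (S : semigroup) (a b : nat -> S) w :
  {in letters w, a =1 b} -> word_eval a w = word_eval b w.
Proof.
case: w => i s; rewrite /word_eval /letters /= => H.
rewrite (H i) ?mem_head//.
have : {in s, a =1 b} by move=> j js; apply: H; rewrite inE js orbT.
by elim: s (b i) {H} => //= j s IH x H; rewrite (H j) ?mem_head// IH// => l ls;
  apply: H; rewrite inE ls orbT.
Qed.

Lemma null_idP (S : semigroup) w :
  satisfies S (null_id w) <-> forall a : nat -> S, null_elt (word_eval a w).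
Proof.
have rconsE (a : nat -> S) j :
    word_eval a (w.1, rcons w.2 j) = sg_mul (word_eval a w) (a j).
  by rewrite /word_eval /= foldl_rcons.
split=> H a; last by rewrite /null_id /= rconsE H.
move=> y; set m := (\max_(i <- letters w) i).+1.
have := H (fun i => if i == m then y else a i).
rewrite /null_id /= rconsE -/m eqxx => E.
suff eqa : word_eval (fun i => if i == m then y else a i) w = word_eval a w.
  by rewrite -{1}eqa -E.
apply: eval_eq_in => i iw; case: eqP => // im.
have : i <= \max_(i <- letters w) i by exact: leq_bigmax_seq.
by rewrite im /m ltnn.
Qed.

Definition comm_id : identity := ((0, [:: 1]), (1, [:: 0])).
(** The trivial variety, the bottom of the lattice. *)
Definition TRIV : SEM := variety_of [set ((0, [::]), (1, [::]))].
Definition COM : SEM := variety_of [set comm_id].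
(** Semilattices. *)
Definition SL : SEM :=
  variety_of [set e | e = comm_id \/ e = ((0, [:: 0]), (0, [::]))].
(** Semigroups with zero multiplication. *)
Definition ZM : SEM := variety_of [set ((0, [:: 1]), (2, [:: 3]))].
(** Abelian groups of exponent dividing n, through x^n y = y; here n > 0. *)
Definition ABEL (n : nat) : SEM :=
  variety_of [set e | e = comm_id \/ e = ((0, rcons (nseq n.-1 0) 1), (1, [::]))].
Definition COMNULL (ws : seq word) : SEM :=
  variety_of [set e | e = comm_id \/ exists2 w, w \in ws & e = null_id w].

Lemma comm_idP (S : semigroup) :
  satisfies S comm_id <-> commutative (@sg_mul S).
Proof.
split=> [H x y|H a]; last exact: H.
by have := H (fun i => if i == 0 then x else y).
Qed.

Lemma in_TRIV (S : semigroup) : members TRIV S <-> (forall x y : S, x = y).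
Proof.
split=> [H x y|H e _ a]; last exact: H.
by have := H _ erefl (fun i => if i == 0 then x else y).
Qed.

Lemma in_COM (S : semigroup) : members COM S <-> commutative (@sg_mul S).
Proof. by rewrite -comm_idP; split=> [H|H e ->]; [exact: H|]. Qed.

Lemma in_SL (S : semigroup) : members SL S <->
  commutative (@sg_mul S) /\ (forall x : S, sg_mul x x = x).
Proof.
rewrite -comm_idP; split=> [H|[H1 H2] e [->//|->] a]; last by apply: H2.
split; first by apply: H; left.
by move=> x; have := H _ (or_intror erefl) (fun=> x).
Qed.

Lemma in_ZM (S : semigroup) :
  members ZM S <-> (forall x y z t : S, sg_mul x y = sg_mul z t).
Proof.
split=> [H x y z t|H e -> a]; last exact: H.
by have := H _ erefl (fun i => nth x [:: x; y; z; t] i).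
Qed.

Lemma in_COMNULL (ws : seq word) (S : semigroup) : members (COMNULL ws) S <->
  commutative (@sg_mul S) /\
  (forall w, w \in ws -> forall a : nat -> S, null_elt (word_eval a w)).
Proof.
rewrite -comm_idP; split=> [H|[H1 H2] e [->//|[w ww ->]]]; last first.
  by apply/null_idP/H2.
split; first by apply: H; left.
by move=> w ww; apply/null_idP; apply: H; right; exists w.
Qed.

Lemma COMNULL_zero ws w : w \in ws -> zero_in (COMNULL ws) w.
Proof. by move=> ww S /in_COMNULL[_]; apply. Qed.

Lemma le_COM_comm V S : (V <= COM)%O -> members V S -> commutative (@sg_mul S).
Proof. by move=> /le_members VC /VC /in_COM. Qed.

Lemma COMNULL_COM ws : (COMNULL ws <= COM)%O.
Proof. by apply/le_members => S /in_COMNULL[cS _]; apply/in_COM. Qed.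

Lemma le_COMNULL V ws : (V <= COM)%O -> {in ws, forall w, zero_in V w} ->
  (V <= COMNULL ws)%O.
Proof.
move=> VC H; apply/le_members => S VS; apply/in_COMNULL; split.
  exact: le_COM_comm VS.
by move=> w ww a; apply: H.
Qed.

Lemma TRIV_le V : (TRIV <= V)%O.
Proof. by apply/le_theory => e _ S /in_TRIV H a; apply: H. Qed.

Lemma le_TRIV V :
  (V <= TRIV)%O <-> (forall S, members V S -> forall x y : S, x = y).
Proof.
by split=> [/le_members H S /H/in_TRIV|H]; [|apply/le_members => S /H ?; apply/in_TRIV].
Qed.

(** * Words that vanish identically *)

Section Comm.
Variables (S : semigroup) (cS : commutative (@sg_mul S)).
Local Notation inj := (inj cS).

Lemma null_absorb s (m : adj cS) : null_elt s -> (inj s + m = inj s)%R.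
Proof. by case: m => [y|] Hs; [rewrite -(injM cS) Hs|rewrite addr0]. Qed.

Lemma null_unique (s s' : S) : null_elt s -> null_elt s' -> s = s'.
Proof. by move=> Hs Hs'; rewrite -(Hs s') cS Hs'. Qed.

Lemma absorb_null s : (forall m : adj cS, inj s + m = inj s)%R -> null_elt s.
Proof. by move=> H y; apply: (@inj_inj S cS); rewrite injM H. Qed.

Lemma eval_perm (a : nat -> S) u v :
  perm_eq (letters u) (letters v) -> word_eval a u = word_eval a v.
Proof.
by move=> uv; apply: (@inj_inj S cS); rewrite !inj_eval; apply: perm_big.
Qed.

Lemma eval_power (a : nat -> S) t : 0 < t ->
  inj (word_eval a (power t)) = (inj (a 0) *+ t)%R.
Proof.
by move=> t0; rewrite inj_eval letters_power// big_nseq iter_addr_0.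
Qed.

Lemma eval_null_letter (a : nat -> S) x u : x \in letters u ->
  null_elt (a x) -> word_eval a u = a x.
Proof.
move=> xu Hx; apply: (@inj_inj S cS); rewrite inj_eval (big_rem x)//=.
exact: null_absorb.
Qed.

(** A word that contains a substitution instance of an identically null word is
    identically null; all zero words below are obtained in this way. *)
Lemma null_image (a : nat -> S) f u v r :
    perm_eq (letters v) (map f (letters u) ++ r) ->
    null_elt (word_eval (a \o f) u) ->
  null_elt (word_eval a v).
Proof.
move=> p H; suff -> : word_eval a v = word_eval (a \o f) u by [].
apply: (@inj_inj S cS); rewrite !inj_eval (perm_big _ p) big_cat big_map /=.
by rewrite -(@inj_eval S cS (a \o f)) null_absorb.
Qed.

Lemma inj_eval_count (a : nat -> S) w N : all (fun i => i < N) (letters w) ->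
  inj (word_eval a w) = (\sum_(j < N) inj (a j) *+ occ j w)%R.
Proof.
move=> /allP H; rewrite inj_eval /occ.
transitivity (\sum_(i <- letters w) \sum_(j < N) inj (a j) *+ (i == j :> nat))%R.
  rewrite [LHS]big_seq [RHS]big_seq; apply: eq_bigr => i /H iN.
  rewrite (bigD1 (Ordinal iN))//= eqxx big1 ?addr0// => j ji.
  by case: eqP => // ij; case/eqP: ji; apply: val_inj.
rewrite exchange_big; apply: eq_bigr => j _.
by rewrite -sum1_count sumrMnr [in RHS]big_mkcond; congr (_ *+ _)%R.
Qed.
End Comm.

Definition letter_bound (u v : word) := (\max_(i <- letters u ++ letters v) i).+1.

Lemma letters_boundl u v : all (fun i => i < letter_bound u v) (letters u).
Proof.
apply/allP => i iu; rewrite ltnS; apply: leq_bigmax_seq => //.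
by rewrite mem_cat iu.
Qed.

Lemma letters_boundr u v : all (fun i => i < letter_bound u v) (letters v).
Proof.
apply/allP => i iu; rewrite ltnS; apply: leq_bigmax_seq => //.
by rewrite mem_cat iu orbT.
Qed.

Lemma occ_perm u v : (forall i, occ i u = occ i v) ->
  perm_eq (letters u) (letters v).
Proof. by move=> H; apply/allP => i _ /=; apply/eqP/H. Qed.

Lemma occ_gt0 i u : (0 < occ i u) = (i \in letters u).
Proof. by rewrite /occ -has_count has_pred1. Qed.

Lemma zero_image V u v f r : (V <= COM)%O ->
  perm_eq (letters v) (map f (letters u) ++ r) -> zero_in V u -> zero_in V v.
Proof.
move=> VC p H S VS a.
exact: (null_image (le_COM_comm VC VS) p) (H S VS _).
Qed.

Lemma zero_eq V u v : theory (members V) (u, v) -> zero_in V u -> zero_in V v.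
Proof. by move=> T H S VS a; rewrite -(T S VS a)/=; apply: H. Qed.

Lemma theory_sym V u v : theory (members V) (u, v) -> theory (members V) (v, u).
Proof. by move=> T S VS a; rewrite (T S VS a). Qed.

(** An explicit nil index t, for use in computations; nil_variety below is the
    equivalent lattice condition. *)
Definition nilexp (V : SEM) (t : nat) :=
  [/\ (V <= COM)%O, 0 < t & zero_in V (power t)].

(** Substituting zero for a letter that occurs on one side only of an identity
    kills that side and leaves the other unchanged. *)
Lemma content_zero V t u v x : nilexp V t -> theory (members V) (u, v) ->
  x \in letters u -> x \notin letters v -> zero_in V v.
Proof.
move=> [VC t0 Vt] T xu xv S VS a.
have cS := le_COM_comm VC VS.
have Hs := Vt S VS a; set s := word_eval a _ in Hs.
pose b i := if i == x then s else a i.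
have bx : b x = s by rewrite /b eqxx.
have <- : word_eval b v = word_eval a v.
  by apply: eval_eq_in => i iv; rewrite /b; case: eqP iv xv => // -> ->.
by rewrite -(T S VS b)/= (eval_null_letter cS xu) bx.
Qed.

(** From u = u r follows u = u r^n for all n, and r^n is eventually zero. *)
Lemma multiple_zero V t u v r : nilexp V t -> theory (members V) (u, v) ->
  perm_eq (letters v) (letters u ++ r) -> r != [::] -> zero_in V u.
Proof.
move=> [VC t0 Vt] T p r0 S VS a.
have cS := le_COM_comm VC VS.
case: r => // i s in p r0 *.
set w := word_eval a u; pose R := inj cS (word_eval a (i, s)).
have E1 : (inj cS w = inj cS w + R)%R.
  rewrite {1}/w (T S VS a) /= inj_eval (perm_big _ p) big_cat /=.
  by rewrite /w /R !inj_eval.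
have E k : (inj cS w = inj cS w + R *+ k)%R.
  by elim: k => [|k IH]; rewrite ?addr0// mulrS addrA -E1.
have := Vt S VS (fun=> word_eval a (i, s)); set z := word_eval _ _ => Hz.
have Ez : inj cS z = (R *+ t)%R by rewrite /z eval_power.
suff -> : w = z by [].
by apply: (@inj_inj S cS); rewrite (E t) -Ez addrC null_absorb.
Qed.

Lemma theory_wmap V u v f : theory (members V) (u, v) ->
  theory (members V) ((f u.1, map f u.2), (f v.1, map f v.2)).
Proof. by move=> T S VS a /=; rewrite !eval_wmap; apply: T. Qed.

Lemma theory_power V u v : theory (members V) (u, v) ->
  theory (members V) (power (size (letters u)), power (size (letters v))).
Proof.
move=> /(theory_wmap (fun=> 0)); rewrite /power /letters /=.
have map0 s : [seq 0 | _ <- s] = nseq (size s) 0 by elim: s => //= _ s ->.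
by rewrite !map0.
Qed.

(** Identifying all letters turns an identity between words of different
    lengths i < j into x^i = x^j, which forces x^i = 0 in a nil variety. *)
Lemma same_length V t u v k : nilexp V t -> theory (members V) (u, v) ->
  0 < k -> ~ zero_in V (power k) -> size (letters u) <= k ->
  size (letters v) = size (letters u).
Proof.
move=> nV /theory_power T k0 Vk uk; have [VC _ _] := nV.
have key i j : 0 < i -> i < j -> i <= k ->
    theory (members V) (power i, power j) -> False.
  move=> i0 ij ik Tij; apply: Vk.
  have /(zero_image VC) : perm_eq (letters (power k))
      (map id (letters (power i)) ++ nseq (k - i) 0).
    by rewrite map_id !letters_power// -nseqD subnKC.
  apply; apply: (multiple_zero nV Tij (r := nseq (j - i) 0)).
    by rewrite !letters_power -?nseqD ?subnKC//; lia.
  by move: ij; rewrite -subn_gt0; case: (j - i).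
case: (ltngtP (size (letters v)) (size (letters u))) => // lt.
  by case: (key _ _ _ lt (ltnW (leq_trans lt uk)) (theory_sym T)).
by case: (key _ _ _ lt uk T).
Qed.

(** * Varieties of abelian groups *)

Definition NULL2 : semigroup :=
  @MkSemigroup bool (fun _ _ => false) (fun _ _ _ => erefl) (inhabits true).
Definition AND2 : semigroup := MkSemigroup andbA (inhabits true).

(** Integers from 0 to n.  The ordinal types live in a universe above the
    one of the carriers of semigroups, which a sigma type over nat does not. *)
Definition residue n : Type := {i : nat | i < n.+1}.
Definition to_residue n i : residue n := exist _ (i %% n.+1) (ltn_pmod i (ltn0Sn n)).
Definition cyc_mul n (x y : residue n) : residue n :=
  to_residue n (sval x + sval y).
Lemma residue_inj n (x y : residue n) : sval x = sval y -> x = y.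
Proof. exact: val_inj. Qed.

Lemma cyc_mulA n : associative (@cyc_mul n).
Proof.
by move=> x y z; apply: residue_inj; rewrite /= modnDml modnDmr addnA.
Qed.
Definition CYC n : semigroup := MkSemigroup (@cyc_mulA n) (inhabits (to_residue n 0)).

Lemma cyc_eval n (a : nat -> CYC n) w :
  sval (word_eval a w) = (\sum_(i <- letters w) sval (a i)) %% n.+1.
Proof.
case: w => i s; rewrite /word_eval /letters /= big_cons.
elim: s (a i) => [|j s IH] x /=; first 
  by rewrite big_nil addn0 modn_small//; case: x.
by rewrite IH /= modnDml big_cons addnA.
Qed.

Definition exp_id j : identity := ((0, rcons (nseq j.-1 0) 1), (1, [::])).

Lemma letters_exp_id j : 0 < j -> letters (exp_id j).1 = rcons (nseq j 0) 1.
Proof. by case: j. Qed.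

Lemma exp_idP S (cS : commutative (@sg_mul S)) j : 0 < j ->
  satisfies S (exp_id j) <->
  (forall x y : S, inj cS x *+ j + inj cS y = inj cS y)%R.
Proof.
move=> j0.
have E a : inj cS (word_eval a (exp_id j).1) = (inj cS (a 0) *+ j + inj cS (a 1))%R.
  rewrite inj_eval letters_exp_id// -cats1 big_cat big_seq1 /=.
  by rewrite big_nseq iter_addr_0.
split=> [H x y|H a]; last by apply: (@inj_inj S cS); rewrite E H.
have := H (fun i => if i == 0 then x else y).
by move/(congr1 (inj cS)); rewrite E.
Qed.

Lemma in_ABEL n S (cS : commutative (@sg_mul S)) : 0 < n ->
  members (ABEL n) S <-> (forall x y : S, inj cS x *+ n + inj cS y = inj cS y)%R.
Proof.
move=> n0; rewrite -exp_idP//; split=> [H|H e [->|->//]].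
  by apply: H; right.
exact/comm_idP.
Qed.

Lemma ABEL_COM n : (ABEL n <= COM)%O.
Proof.
by apply/le_members => S H; apply/in_COM/comm_idP/H; left.
Qed.

Lemma le_ABEL V n : (V <= COM)%O -> theory (members V) (exp_id n) ->
  (V <= ABEL n)%O.
Proof.
move=> VC H; apply/le_members => S VS e [->|->]; last exact: H.
exact/comm_idP/(le_COM_comm VC).
Qed.

(** Both sides absorb n-th powers.  Multiplying u by (x_j^n)^(c_j) for suitable
    c_j, and v likewise, makes the multiplicities of u and v equal. *)
Lemma ABEL_sat n u v : 0 < n -> (forall i, occ i u = occ i v %[mod n]) ->
  theory (members (ABEL n)) (u, v).
Proof.
move=> n0 H S AS a; have cS := le_COM_comm (ABEL_COM n) AS.
have /(in_ABEL cS n0) E := AS.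
have absorb (y : S) (m : adj cS) : (inj cS y + m *+ n = inj cS y)%R.
  by case: m => [x|]; rewrite ?mul0rn ?addr0// addrC E.
apply: (@inj_inj S cS) => /=.
set N := letter_bound u v.
pose q w := (\sum_(j < N) inj cS (a j) *+ (occ j w %/ n))%R.
rewrite -(absorb _ (q v)) -[in RHS](absorb _ (q u)) /q.
rewrite (inj_eval_count cS a (letters_boundl u v)) (inj_eval_count cS a (letters_boundr u v)).
rewrite -!sumrMnl -!big_split; apply: eq_bigr => j _ /=.
rewrite -!mulrnA -!mulrnDr; congr (_ *+ _)%R.
by rewrite {1}(divn_eq (occ j u) n) {2}(divn_eq (occ j v) n) (H j) /=; lia.
Qed.

Lemma CYC_ABEL n : members (ABEL n.+1) (CYC n).
Proof.
move=> e [->|->] a; apply: residue_inj; rewrite !cyc_eval.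
  by rewrite /letters /= !big_cons !big_nil !addn0 addnC.
rewrite letters_exp_id// -cats1 big_cat big_nseq iter_addn_0 /=.
by rewrite /letters /= !big_seq1 modnMDl.
Qed.

(** In the cyclic group of order n, send one letter to 1 and the others to 0. *)
Lemma ABEL_theory n u v : 0 < n -> theory (members (ABEL n)) (u, v) ->
  forall i, occ i u = occ i v %[mod n].
Proof.
case: n => // n _ H i.
case: n H => [|n] H; first by rewrite !modn1.
have := H _ (@CYC_ABEL n.+1) (fun j => to_residue n.+1 (j == i)).
move/(congr1 sval); rewrite !cyc_eval /=.
have E w : \sum_(j <- letters w) (j == i) %% n.+2 = occ i w.
  rewrite /occ -sum1_count [RHS]big_mkcond; apply: eq_bigr => j _ /=.
  by case: (j == i).
by rewrite !E.
Qed.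

Lemma ABEL_dvd m n : 0 < m -> 0 < n -> (ABEL m <= ABEL n)%O <-> m %| n.
Proof.
move=> m0 n0; split=> [/le_theory H|mn].
  have /H/(ABEL_theory m0)/(_ 0) : theory (members (ABEL n)) (exp_id n).
    by move=> S; apply; right.
  rewrite /occ letters_exp_id// -cats1 count_cat count_nseq /= mul1n addn0.
  by rewrite addn0 mod0n => /eqP.
apply: le_ABEL (ABEL_COM m) _ => S AS.
have cS := le_COM_comm (ABEL_COM m) AS; have /(in_ABEL cS m0) E := AS.
apply/(exp_idP cS n0) => x y; case/dvdnP: mn => k ->.
by rewrite mulnC mulrnA; elim: k => [|k IH]; rewrite ?mul0r ?add0r//
  -mulrnA mulnSr mulrnDr mulrnA addrAC IH addrC E.
Qed.

Lemma ABEL_TRIV n : 0 < n -> (ABEL n <= TRIV)%O <-> n = 1.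
Proof.
move=> n0; split=> [|->].
  case: n n0 => [//|[//|n]] _ /le_TRIV/(_ _ (@CYC_ABEL n.+1)).
  by move/(_ (to_residue n.+1 0) (to_residue n.+1 1))/(congr1 sval).
apply/le_TRIV => S AS x y; have cS := le_COM_comm (ABEL_COM 1) AS.
have /(in_ABEL cS (ltn0Sn 0)) E := AS.
by apply: (@inj_inj S cS); rewrite -[LHS](E y) -[RHS](E x) !mulr1n addrC.
Qed.

Lemma eval_two S (cS : commutative (@sg_mul S)) i x e w :
  (inj cS (word_eval (fun j => if j == i then x else e) w) =
   inj cS x *+ occ i w + inj cS e *+ (size (letters w) - occ i w))%R.
Proof.
rewrite inj_eval (bigID (fun j => j == i)) /=; congr (_ + _)%R.
  rewrite (eq_bigr (fun=> inj cS x)); last by move=> j /eqP ->; rewrite eqxx.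
  by rewrite big_const_seq iter_addr_0.
rewrite (eq_bigr (fun=> inj cS e)); last by move=> j; case: eqP.
by rewrite big_const_seq iter_addr_0 -[(size w.2).+1](count_predC (pred1 i) (letters w)) /occ (addKn (count_mem i _)).
Qed.

(** The exponent d of V is the least positive j such that x^j y = y holds in V.
    An identity u = v of V yields x^p y = x^q y, where p and q are the
    multiplicities of a given letter, by sending all other letters to an
    identity element; minimality of d then gives p = q modulo d. *)
Lemma sub_ABEL V N : 0 < N -> (V <= ABEL N)%O -> exists2 d, 0 < d & V = ABEL d.
Proof.
move=> N0 VN; have VC := le_trans VN (ABEL_COM N).
have VNid : theory (members V) (exp_id N).
  by move/le_theory: VN => H; apply: H => S; apply; right.
pose D j := (0 < j) && `[< theory (members V) (exp_id j) >].
have exD : exists j, D j by exists N; rewrite /D N0; apply/asboolP.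
have [d /andP[d0 /asboolP Vd] dmin] := ex_minnP exD.
exists d => //; apply/eqP; rewrite eq_le le_ABEL//; apply/le_theory => -[u v] T.
apply: ABEL_sat => // i.
have key p q : p <= q -> (forall S (VS : members V S) (cS : commutative (@sg_mul S))
    (x y : S), inj cS x *+ p + inj cS y = inj cS x *+ q + inj cS y)%R ->
    p = q %[mod d].
  move=> pq H; apply/esym/eqP; rewrite eqn_mod_dvd//; set r := q - p.
  rewrite /dvdn; have [//|r0] := posnP (r %% d).
  suff : D (r %% d) by move/dmin; rewrite leqNgt ltn_mod d0.
  rewrite /D r0; apply/asboolP => S VS; have cS := le_COM_comm VC VS.
  apply/(exp_idP cS r0) => x y.
  have mul k j : (forall y : S, inj cS x *+ k + inj cS y = inj cS y)%R ->
      forall y : S, (inj cS x *+ (j * k) + inj cS y = inj cS y)%R.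
    move=> Hk y'; elim: j => [|j IH]; first by rewrite add0r.
    by rewrite mulSn mulrnDr -addrA IH Hk.
  have Hd : (forall y : S, inj cS x *+ d + inj cS y = inj cS y)%R.
    by move=> y'; apply: (exp_idP cS d0).1 => //; apply: Vd.
  have HN : (forall y : S, inj cS x *+ N + inj cS y = inj cS y)%R.
    by move=> y'; apply: (exp_idP cS N0).1 => //; apply: VNid.
  have Hr : (inj cS x *+ r + inj cS y = inj cS y)%R.
    have Np : p * N = p * N.-1 + p by rewrite -{1}(prednK N0) mulnS addnC.
    rewrite -[in RHS](mul _ p HN y) Np mulrnDr -addrA (H S VS cS x y) addrA -mulrnDr.
    have -> : p * N.-1 + q = r + p * N by rewrite Np /r; lia.
    by rewrite mulrnDr -addrA (mul _ p HN).
  rewrite -[RHS]Hr [in RHS](divn_eq r d) mulrnDr -[in RHS]addrA [in RHS]addrCA.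
  by rewrite (mul _ _ Hd).
have E S (VS : members V S) (cS : commutative (@sg_mul S)) (x y : S) :
    (inj cS x *+ occ i u + inj cS y = inj cS x *+ occ i v + inj cS y)%R.
  pose e := word_eval (fun=> y) (power N).
  have Ee k : (inj cS e *+ k + inj cS y = inj cS y)%R.
    have Hy : (inj cS e + inj cS y = inj cS y)%R.
      by rewrite /e eval_power//; apply: (exp_idP cS N0).1 => //; apply: VNid.
    by elim: k => [|k IH]; rewrite ?add0r// mulrS -addrA IH Hy.
  have := T S VS (fun j => if j == i then x else e).
  move/(congr1 (inj cS)); rewrite !eval_two => /(congr1 (+%R^~ (inj cS y))).
  by rewrite -!addrA !Ee.
by case: (leqP (occ i u) (occ i v)) => [|/ltnW] le; [|symmetry];
  apply: key le _ => S VS cS x y; rewrite (E S VS).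
Qed.

(** * Varieties omitting an atom *)

Lemma NULL2_ZM : members ZM NULL2.
Proof. exact/in_ZM. Qed.

Lemma AND2_SL : members SL AND2.
Proof. by apply/in_SL; split; [exact: andbC|exact: andbb]. Qed.

Lemma SL_COM : (SL <= COM)%O.
Proof. by apply/le_members => S /in_SL[cS _]; apply/in_COM. Qed.

Lemma ZM_COM : (ZM <= COM)%O.
Proof. by apply/le_members => S /in_ZM H; apply/in_COM => x y; apply: H. Qed.

Lemma COM_sat u v : perm_eq (letters u) (letters v) ->
  theory (members COM) (u, v).
Proof. by move=> p S /in_COM cS a; apply: eval_perm. Qed.

Lemma SL_sat u v : letters u =i letters v -> theory (members SL) (u, v).
Proof.
move=> uv S /in_SL[cS idem] a; apply: (@inj_inj S cS) => /=.
rewrite (inj_eval_count cS a (letters_boundl u v)) (inj_eval_count cS a (letters_boundr u v)).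
have E x k : (inj cS x *+ k.+1 = inj cS x)%R.
  by elim: k => // k IH; rewrite mulrS IH -injM idem.
apply: eq_bigr => j _; have := uv j; rewrite -!occ_gt0.
by case: (occ j u) (occ j v) => [|p] [|q] //=; rewrite !E.
Qed.

Lemma not_SL V : ~ (SL <= V)%O -> exists u v x,
  [/\ theory (members V) (u, v), x \in letters u & x \notin letters v].
Proof.
move=> H; apply: contrapT => K; apply/H/le_theory => -[u v] T.
apply: SL_sat => x; apply/idP/idP => xx; apply: contrapT => /negP nx; apply: K.
  by exists u, v, x.
by exists v, u, x; split=> //; apply: theory_sym.
Qed.

(** All words of length at least 2 have the same value in a null semigroup, so
    an identity that fails there has a letter as one of its sides. *)
Lemma not_ZM V : ~ (ZM <= V)%O ->
  exists2 k, 0 < k & theory (members V) (power 1, power k.+1).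
Proof.
move=> H.
have [u [v [T u1 uv]]] : exists u v,
    [/\ theory (members V) (u, v), size (letters u) = 1 & u <> v].
  apply: contrapT => K; apply/H/le_theory => -[u v] T S /in_ZM HS a.
  case: u v T => i s [j t] T /=.
  case: (lastP s) T => [|s' i'] T.
    case: (pselect ((i, [::]) = (j, t))) => [[-> <-]//|ne].
    by case: K; exists (i, [::]), (j, t).
  case: (lastP t) T => [|t' j'] T.
    by case: K; exists (j, [::]), (i, rcons s' i'); split=> //;
      [exact: theory_sym|case=> _; case: s' {T}].
  by rewrite /word_eval /= !foldl_rcons; apply: HS.
have := theory_power T; rewrite u1.
case: v T uv => j [|j' t] /= T uv Tp; last by exists (size t).+1.
exists 1 => // S VS a; case: u T u1 uv {Tp} => i [|//] T _ uv /=.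
have ij : (j == i) = false by apply/eqP => ij; apply: uv; rewrite ij.
have := T S VS (fun l => if l == i then word_eval a (power 1)
  else word_eval a (power 2)).
by rewrite /word_eval /= eqxx ij.
Qed.

(** The power x^(n+1).  The shift avoids a unit, which matters where
    commutativity is not available. *)
Definition spow (S : semigroup) (x : S) n : S := iter n (fun y => sg_mul y x) x.

Lemma spowD (S : semigroup) (x : S) m n : sg_mul (spow x m) (spow x n) = spow x (m + n).+1.
Proof.
elim: n => [|n IH] /=; first by rewrite addn0.
by rewrite sg_mulA IH addnS.
Qed.

Lemma spow_eval (S : semigroup) (x : S) f w :
  word_eval (fun i => spow x (f i)) w =
  spow x (\sum_(i <- letters w) (f i).+1).-1.
Proof.
case: w => i s; rewrite /word_eval /letters /= big_cons ?addSn /=.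
elim: s (f i) => [|j s IH] n /=; first by rewrite big_nil addn0.
by rewrite spowD IH big_cons; congr spow; lia.
Qed.

Lemma spow_power (S : semigroup) (x : S) n :
  word_eval (fun=> x) (power n.+1) = spow x n.
Proof.
have := spow_eval x (fun=> 0) (power n.+1); rewrite /= => ->.
by rewrite letters_power// big_nseq iter_addn_0 mul1n.
Qed.

Lemma inj_spow (S : semigroup) (cS : commutative (@sg_mul S)) (x : S) n :
  (inj cS (spow x n) = inj cS x *+ n.+1)%R.
Proof. by elim: n => //= n IH; rewrite injM IH -mulrSr. Qed.

(** If g generates a cyclic group of order d > 1, take a prime p dividing d:
    evaluating the identities of V at powers of g shows that they balance each
    letter modulo p, hence that they hold in abelian groups of exponent p. *)
Lemma cyclic (V : SEM) (S : semigroup) (g : S) k : members V S -> 0 < k -> spow g k = g ->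
  spow g 1 <> g -> exists2 p, prime p & (ABEL p <= V)%O.
Proof.
move=> VS k0 gk g1.
pose D j := (0 < j) && `[< spow g j = g >].
have exD : exists j, D j by exists k; rewrite /D k0; apply/asboolP.
have [d /andP[d0 /asboolP gd] dmin] := ex_minnP exD.
have d1 : 1 < d.
  by rewrite ltn_neqAle d0 andbT; apply/eqP => d1; apply: g1; rewrite d1.
have per r q : spow g (q * d + r) = spow g r.
  have per1 a : spow g (a + d) = spow g a.
    case: a => [|a]; first by rewrite add0n.
    by rewrite addSn -spowD gd -[X in sg_mul _ X]/(spow g 0) spowD addn0.
  by elim: q => // q IH; rewrite mulSn -addnA addnC per1.
have inj_pow a b : spow g a = spow g b -> a = b %[mod d].
  wlog ab : a b / a <= b => [W H|H].
    by case: (leqP a b) => [/W|/ltnW /W] ->.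
  apply/esym/eqP; rewrite eqn_mod_dvd//; set r := b - a.
  rewrite /dvdn; have [//|r0] := posnP (r %% d).
  suff : D (r %% d) by move/dmin; rewrite leqNgt ltn_mod d0.
  rewrite /D r0; apply/asboolP.
  have add c : spow g (a + c) = spow g (b + c).
    by case: c => [|c]; rewrite ?addn0// !addnS -!spowD H.
  have ad : a + a * d.-1 = a * d by rewrite -mulnS prednK.
  have := add (a * d.-1); rewrite ad.
  have -> : b + a * d.-1 = (a + r %/ d) * d + r %% d.
    by rewrite mulnDl -addnA -divn_eq -ad /r; lia.
  by rewrite per -[a * d]addn0 per => <-.
(* The letter i goes to an element of order p, the others to the identity. *)
exists (pdiv d); first exact: pdiv_prime.
set p := pdiv d; have pd : p %| d := pdiv_dvd d.
have p0 : 0 < p := pdiv_gt0 d.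
have q0 : 0 < d %/ p by rewrite divn_gt0// dvdn_leq.
apply/le_theory => -[u v] T; apply: ABEL_sat => // i.
have := T S VS (fun j => spow g (if j == i then (d %/ p).-1 else d.-1)).
rewrite !spow_eval => /inj_pow.
have E w : (\sum_(j <- letters w) (if j == i then (d %/ p).-1 else d.-1).+1).-1.+1 =
     d %/ p * occ i w + d * (size (letters w) - occ i w).
  rewrite prednK; last by rewrite /letters /= big_cons addSn.
  rewrite (bigID (fun j => j == i)) /=; congr (_ + _).
    rewrite (eq_bigr (fun=> d %/ p)); last by move=> j ->; rewrite prednK.
    by rewrite big_const_seq iter_addn_0.
  rewrite (eq_bigr (fun=> d)); last by move=> j /negbTE ->; rewrite prednK.
  rewrite big_const_seq iter_addn_0.
  by rewrite -[(size w.2).+1](count_predC (pred1 i) (letters w)) /occ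
    (addKn (count_mem i _)).
move=> /eqP; rewrite -(eqn_modDr 1) !addn1 !E.
rewrite -!(addnC (d * _)) !(mulnC d (_ - _)) !modnMDl -{2 4}(divnK pd).
rewrite -!muln_modr => /eqP/eqP; rewrite eqn_pmul2l// => /eqP.
by [].
Qed.

(** An identity with a letter x on its left side only becomes, when the other
    letters are identified, s^i r^j = r^l.  As s is arbitrary, powers of r are
    eventually periodic with period i, and s^i fixes the large powers of r.
    Hence s^M r^M = r^M for a common M, and s^M = r^M by symmetry. *)
Lemma common_power V : (V <= COM)%O -> ~ (SL <= V)%O ->
  exists2 M, 0 < M & forall (S : semigroup) (cS : commutative (@sg_mul S)),
    members V S -> forall x y : S, (inj cS x *+ M = inj cS y *+ M)%R.
Proof.
move=> VC /not_SL [u [v [x0 [T xu xv]]]].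
set i := occ x0 u; pose j := (size (letters u) - i).+1.
pose l := (size (letters v)).+1.
have i0 : 0 < i by rewrite occ_gt0.
have H0 (S : semigroup) (cS : commutative (@sg_mul S)) : members V S ->
    forall s r : S, (inj cS s *+ i + inj cS r *+ j = inj cS r *+ l)%R.
  move=> VS s r; have := T S VS (fun n => if n == x0 then s else r).
  move/(congr1 (inj cS)); rewrite !eval_two -/i.
  have -> : occ x0 v = 0 by apply/eqP; rewrite -leqn0 leqNgt occ_gt0.
  by rewrite mulr0n add0r subn0 /j /l !mulrSr addrA => ->.
exists (i * (i + j)); first by rewrite muln_gt0 i0 addn_gt0 i0.
move=> S cS VS.
have key (s r : S) : (inj cS s *+ (i * (i + j)) + inj cS r *+ (i * (i + j)) =
    inj cS r *+ (i * (i + j)))%R.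
  have Hl : (inj cS r *+ (i + j) = inj cS r *+ l)%R by rewrite mulrnDr H0.
  have Hl2 : (inj cS r *+ (i + (i + j)) = inj cS r *+ (i + j))%R.
    by rewrite Hl -(H0 S cS VS (sg_mul r r) r) injM -mulr2n -mulrnA -mulrnDr;
      congr (_ *+ _)%R; lia.
  have Hs : (inj cS s *+ i + inj cS r *+ (i + j) = inj cS r *+ (i + j))%R.
    by rewrite [in LHS](mulrnDr _ i j) addrCA (H0 S cS VS) -Hl -mulrnDr Hl2.
  have Hr q : (inj cS s *+ (i * q) + inj cS r *+ (i + j) = inj cS r *+ (i + j))%R.
    by elim: q => [|q IH]; rewrite ?muln0 ?add0r// mulnSr mulrnDr -addrA Hs.
  have le : i + j <= i * (i + j) by rewrite leq_pmull.
  by rewrite -{2 3}(subnKC le) [in LHS]mulrnDr addrA Hr -mulrnDr.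
move=> x y; rewrite -[RHS](key x y) addrC.
by rewrite key.
Qed.

Lemma ABEL_no_ZM n : 0 < n -> ~ (ZM <= ABEL n)%O.
Proof.
move=> n0 /le_members/(_ _ NULL2_ZM) H.
have cS := le_COM_comm (ABEL_COM n) H.
have /(in_ABEL cS n0)/(_ true true) := H.
by case: n n0 {H} => //= n _; rewrite mulrS addrAC -injM; case: (_ *+ _)%R => [[]|].
Qed.

Lemma ABEL_no_SL n : 0 < n -> ~ (SL <= ABEL n)%O.
Proof.
move=> n0 /le_members/(_ _ AND2_SL) H.
have cS := le_COM_comm (ABEL_COM n) H.
have /(in_ABEL cS n0)/(_ false true) := H.
by case: n n0 {H} => //= n _; rewrite mulrS addrAC -injM; case: (_ *+ _)%R => [[]|].
Qed.

Lemma SL_no_ZM : ~ (ZM <= SL)%O.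
Proof. by move=> /le_members/(_ _ NULL2_ZM)/in_SL[_ /(_ true)]. Qed.

(** Varieties of abelian groups, described inside the lattice: the commutative
    varieties that contain neither null semigroups nor semilattices. *)
Definition group_variety (A : SEM) : Prop :=
  [/\ (A <= COM)%O, ~ (ZM <= A)%O & ~ (SL <= A)%O].

(** Without ZM there is k > 0 such that x = x^(k+1); without SL all M-th powers have
    a common value, and this value is an identity element. *)
Lemma group_varietyP V : group_variety V <-> exists2 n, 0 < n & V = ABEL n.
Proof.
split=> [[VC /not_ZM[k k0 Tk] /(common_power VC)[M M0 HM]]|[n n0 ->]]; last first.
  by split; [exact: ABEL_COM|exact: ABEL_no_ZM|exact: ABEL_no_SL].
apply: (sub_ABEL M0); apply: le_ABEL => // S VS.
have cS := le_COM_comm VC VS; apply/(exp_idP cS M0) => x y.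
have E : (inj cS y = inj cS y *+ k.+1)%R.
  by have := Tk S VS (fun=> y); move/(congr1 (inj cS)); rewrite !eval_power.
have Ek q : (inj cS y = inj cS y + inj cS y *+ (k * q))%R.
  elim: q => [|q IH]; first by rewrite muln0 addr0.
  by rewrite mulnSr mulrnDr addrA -IH -mulrS -E.
have EM : (inj cS y *+ M = inj cS y *+ (k * M))%R.
  by rewrite (HM S cS VS y (spow y k.-1)) inj_spow prednK// mulrnA.
by rewrite (HM S cS VS x y) addrC EM -Ek.
Qed.

Lemma idempotent_of (V : SEM) : ~ (ZM <= V)%O ->
  (forall p, prime p -> ~ (ABEL p <= V)%O) ->
  forall S, members V S -> forall x : S, sg_mul x x = x.
Proof.
move=> /not_ZM[k k0 Tk] nA S VS x; apply: contrapT => nx.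
have gk : spow x k = x.
  by rewrite -spow_power -(Tk S VS (fun=> x)).
by have [p /nA] := cyclic VS k0 gk nx.
Qed.

(** Let e be the common value of all M-th powers.  Then g = x e lies in a group
    with identity e whose exponent divides M.  If g were not e, some ABEL p would
    be contained in V; so x e = e for all x, that is, e is a zero. *)
Lemma nilexp_of (V : SEM) : (V <= COM)%O -> ~ (SL <= V)%O ->
  (forall p, prime p -> ~ (ABEL p <= V)%O) -> exists t, nilexp V t.
Proof.
move=> VC /(common_power VC)[M M0 HM] nA; exists M; split=> // S VS a.
have cS := le_COM_comm VC VS; move: (a 0) (eval_power cS a M0) => x Ee.
apply: absorb_null => m; rewrite Ee.
suff key (y : S) : (inj cS x *+ M + inj cS y = inj cS x *+ M)%R.
  by case: m => [y|]; [apply: key|apply: addr0].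
rewrite (HM S cS VS x y).
have Ej j : (inj cS y *+ (j.+1 * M) = inj cS y *+ M)%R.
  by rewrite (HM S cS VS y (spow y j)) inj_spow mulrnA.
have g1 : spow (spow y M) 1 = spow y M.
  apply: contrapT => ng.
  have gM : spow (spow y M) M = spow y M.
    apply: (@inj_inj S cS); rewrite !inj_spow -mulrnA mulnS mulrnDr Ej.
    by rewrite mulrSr addrAC -mulrnDr addnn -mul2n Ej.
  by have [p /nA] := cyclic VS M0 gM ng.
have : forall q, spow (spow y M) q = spow y M.
  by elim=> // q IH; rewrite -[in LHS](addn0 q) -spowD IH; exact: g1.
move/(_ M.-1)/(congr1 (inj cS)); rewrite !inj_spow prednK// -mulrnA Ej mulrSr.
by move=> <-.
Qed.

Lemma zero_power_trivial V t k : (V <= COM)%O -> zero_in V (power t) ->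
  0 < t -> 0 < k -> theory (members V) (power 1, power k.+1) -> (V <= TRIV)%O.
Proof.
move=> VC Vt t0 k0 Tk; apply/le_TRIV => S VS x y.
have cS := le_COM_comm VC VS.
suff null z : null_elt (z : S) by apply: (null_unique cS).
have E : (inj cS z = inj cS z *+ k.+1)%R.
  by have := Tk S VS (fun=> z); move/(congr1 (inj cS)); rewrite !eval_power.
have Ek q : (inj cS z = inj cS z + inj cS z *+ (k * q))%R.
  elim: q => [|q IH]; first by rewrite muln0 addr0.
  by rewrite mulnSr mulrnDr addrA -IH -mulrS -E.
have := Vt S VS (fun=> z); set w := word_eval _ _ => Hw.
suff -> : z = w by [].
apply: (@inj_inj S cS).
have Ew : inj cS w = (inj cS z *+ t)%R by rewrite /w eval_power.
rewrite (Ek t) mulnC mulrnA -Ew.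
by rewrite -(prednK k0) mulrS addrCA null_absorb.
Qed.

(** The lattice form of the existence of a nil index: a variety avoiding ZM
    satisfies x = x^(k+1) for some k > 0, so that no power of x can be zero in it
    unless it is trivial. *)
Definition nil_variety (V : SEM) : Prop := (V <= COM)%O /\
  forall b : SEM, (b <= V)%O -> ~ (b <= TRIV)%O -> (ZM <= b)%O.

Lemma SL_nontrivial : ~ (SL <= TRIV)%O.
Proof. by move=> /le_TRIV/(_ _ AND2_SL true false). Qed.

Lemma ZM_nontrivial : ~ (ZM <= TRIV)%O.
Proof. by move=> /le_TRIV/(_ _ NULL2_ZM true false). Qed.

Lemma ABEL_nontrivial n : 1 < n -> ~ (ABEL n <= TRIV)%O.
Proof. by move=> n1 /ABEL_TRIV E; move: (n1); rewrite E// ltnW. Qed.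

Lemma nil_varietyP V : nil_variety V <-> exists t, nilexp V t.
Proof.
split=> [[VC H]|[t [VC t0 Vt]]].
  apply: nilexp_of => // [SV|p pp AV].
    exact/SL_no_ZM/H/SL_nontrivial.
  by apply/(ABEL_no_ZM (prime_gt0 pp))/H/ABEL_nontrivial/prime_gt1.
split=> // b bV nb; apply: contrapT => /not_ZM[k k0 Tk]; apply: nb.
apply: zero_power_trivial t0 k0 Tk; first exact: le_trans bV VC.
by move/le_members: bV => bV S /bV/Vt.
Qed.

(** * Truncated semigroups *)

Section Truncated.
Variables (k : nat) (sqfree : bool).

(** Elements are pairs (degree, label).  Products whose degree reaches k are
    collapsed to the zero (k, 0); a generator has degree 0, so a word of length
    n has degree n - 1.  The labels are integers multiplied in the usual way.
    If sqfree holds, a product is also collapsed unless the labels are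
    coprime and greater than 1, which makes all squares zero. *)
Definition trunc_ok (p q : nat * nat) : bool :=
  (p.1 + q.1 + 1 < k) &&
  (sqfree ==> [&& 1 < p.2, 1 < q.2 & coprime p.2 q.2]).

Definition trunc_mul (p q : nat * nat) : nat * nat :=
  if trunc_ok p q then (p.1 + q.1 + 1, p.2 * q.2) else (k, 0).

Lemma trunc_ok_zerol p : trunc_ok (k, 0) p = false.
Proof. by rewrite /trunc_ok /= -addnA ltnNge leq_addr. Qed.

Lemma trunc_ok_zeror p : trunc_ok p (k, 0) = false.
Proof. by rewrite /trunc_ok /= addnAC ltnNge leq_addl. Qed.

Lemma trunc_mulA : associative trunc_mul.
Proof.
move=> p q r; rewrite /trunc_mul.
case pq: (trunc_ok p q); case qr: (trunc_ok q r); rewrite ?trunc_ok_zerol ?trunc_ok_zeror //.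
- have -> : trunc_ok (p.1 + q.1 + 1, p.2 * q.2) r =
      trunc_ok p (q.1 + r.1 + 1, q.2 * r.2).
    move: pq qr; rewrite /trunc_ok /= => /andP[_ pq] /andP[_ qr].
    congr (_ && _); first by lia.
    case: sqfree pq qr => //= /and3P[p1 q1 cpq] /and3P[_ r1 cqr].
    have -> : 1 < p.2 * q.2 by rewrite (leq_trans p1)// leq_pmulr// ltnW.
    have -> : 1 < q.2 * r.2 by rewrite (leq_trans q1)// leq_pmulr// ltnW.
    by rewrite coprimeMl coprimeMr cpq cqr p1 r1 /= andbT.
  by case: ifP => // _; congr (_, _); rewrite /= ?mulnA //; lia.
- case: ifP => // ok; move: pq qr ok; rewrite /trunc_ok /=.
  move=> /andP[_ pq] /negbT; rewrite negb_and => qr /andP[l ok]; exfalso.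
  case/orP: qr; first by lia.
  case: sqfree pq ok => //= /and3P[_ q1 _] /and3P[_ r1].
  by rewrite coprimeMl q1 r1 => /andP[_ ->].
- case: ifP => // ok; move: pq qr ok; rewrite /trunc_ok /=.
  move=> /negbT; rewrite negb_and => pq /andP[_ qr] /andP[l ok]; exfalso.
  case/orP: pq; first by lia.
  case: sqfree qr ok => //= /and3P[q1 _ _] /and3P[p1 _].
  by rewrite coprimeMr q1 p1 => /andP[-> _].
Qed.

Lemma trunc_mulC : commutative trunc_mul.
Proof.
move=> p q; rewrite /trunc_mul.
have -> : trunc_ok p q = trunc_ok q p.
  rewrite /trunc_ok (addnC p.1); congr (_ && (_ ==> _)).
  by rewrite coprime_sym andbCA.
by rewrite (addnC p.1) mulnC.
Qed.

Definition TRUNC : semigroup := MkSemigroup trunc_mulA (inhabits (0, 0)).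

Lemma trunc_null (s : TRUNC) : null_elt s <-> s = (k, 0).
Proof.
split=> [/(_ s)|-> y]; rewrite /= /trunc_mul ?trunc_ok_zerol//.
by case: ifP => // _ /(congr1 fst) /=; lia.
Qed.

Lemma trunc_long (a : nat -> TRUNC) w : 0 < k ->
  k < size (letters w) -> word_eval a w = (k, 0).
Proof.
have deg v : word_eval a v = (k, 0) \/ size (letters v) <= (word_eval a v).1.+1.
  case: v => i s; elim/last_ind: s => [|s j IH]; first by right.
  have -> : word_eval a (i, rcons s j) = trunc_mul (word_eval a (i, s)) (a j).
    by rewrite /word_eval /= foldl_rcons.
  rewrite /trunc_mul; case: ifP => ok; [right|by left].
  case: IH ok => [->|]; first by rewrite trunc_ok_zerol.
  by rewrite /letters /= size_rcons => IH _; lia.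
move=> k0 kw; case: (deg w) => // dw; case: w kw dw => i s.
case/lastP: s => [|s j]; rewrite /letters /= ?size_rcons; first by lia.
rewrite /word_eval /= foldl_rcons /= /trunc_mul; case: ifP => //.
by move=> /andP[l _] /=; lia.
Qed.
End Truncated.

Lemma trunc_short k (c : nat -> nat) w : size (letters w) <= k ->
  word_eval (S := TRUNC k false) (fun i => (0, c i)) w =
  ((size (letters w)).-1, \prod_(i <- letters w) c i).
Proof.
case: w => i s; rewrite /word_eval /letters /= big_cons.
have E l m : l + size s < k ->
    foldl (fun x j => trunc_mul k false x (0, c j)) (l, m) s =
    (l + size s, m * \prod_(j <- s) c j).
  elim: s l m => [|j s IH] l m /= lk; first by rewrite big_nil addn0 muln1.
  rewrite {2}/trunc_mul /trunc_ok /= andbT addn0.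
  rewrite ifT; last by lia.
  by rewrite IH ?big_cons ?mulnA; [congr (_, _); lia|lia].
exact: (E 0 (c i)).
Qed.

Definition NILPOTENT (k : nat) : SEM := COMNULL [:: linear k].
(** Only the linear words of length less than j are nonzero here, so that these
    varieties form a chain; they measure the length of nonzero products. *)
Definition NILPOTENT2 (j : nat) : SEM := COMNULL [:: power 2; linear j].

Lemma TRUNC_NILPOTENT k b : 0 < k -> members (NILPOTENT k.+1) (TRUNC k b).
Proof.
move=> k0; apply/in_COMNULL; split=> [|w]; first exact: trunc_mulC.
rewrite inE => /eqP -> a; apply/trunc_null; apply: trunc_long => //.
by rewrite letters_linear// size_iota.
Qed.

Lemma TRUNC_NILPOTENT2 k : 0 < k -> members (NILPOTENT2 k.+1) (TRUNC k true).
Proof.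
move=> k0; apply/in_COMNULL; split=> [|w]; first exact: trunc_mulC.
rewrite !inE => /orP[] /eqP -> a; apply/trunc_null; last first.
  by apply: trunc_long => //; rewrite letters_linear// size_iota.
rewrite /word_eval /= /trunc_mul /trunc_ok /= /coprime gcdnn.
by case: ifP => // /andP[_ /and3P[+ _ /eqP E]]; rewrite E.
Qed.

(** The product of pairwise coprime integers is nonzero in the square-free
    truncated semigroup as long as it has at most k factors.  The recurrence
    P (n+1) = P n * (P n + 1) provides the factors P n + 1: each of them is coprime
    to the product P n of the preceding ones. *)
Lemma NILPOTENT2_linear_le k i : 0 < k -> zero_in (NILPOTENT2 k.+1) (linear i.+1) -> k <= i.
Proof.
move=> k0 H; rewrite leqNgt; apply/negP => ik.
(* P 0 = 1, and P n is the product of the first n factors. *)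
pose P := fix P n := if n is m.+1 then P m * (P m).+1 else 1.
have P0 n : 0 < P n by elim: n => //= n IH; rewrite muln_gt0 IH.
have P1 n : 1 < P n.+1 by have := P0 n => /=; lia.
have /trunc_null := H _ (TRUNC_NILPOTENT2 k0) (fun i => (0, (P i).+1)).
suff -> : word_eval (S := TRUNC k true) (fun i => (0, (P i).+1)) (linear i.+1) =
    (i, P i.+1) by move=> [E _]; move: ik; rewrite E ltnn.
elim: i ik {H} => [|i IH] ik; first by rewrite /word_eval /= mul1n.
have -> : linear i.+2 = ((linear i.+1).1, rcons (linear i.+1).2 i.+1).
  by rewrite /linear /= -[in RHS]add1n -(cats1 (iota 1 i)) -(iotaD 1 i 1) addn1.
rewrite /word_eval /= foldl_rcons -/(word_eval _ (0, iota 1 i)).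
rewrite (_ : foldl _ _ _ = (i, P i.+1)); last exact: IH (ltnW ik).
have [c1 c2] : 1 < P i * (P i).+1 /\ 0 < P i * (P i).+1 by split; [exact: P1|exact: P0 i.+1].
by rewrite /trunc_mul /trunc_ok /= addn0 addn1 ik c1 ltnS c2 coprimenS.
Qed.

(** * Nilpotent varieties and chains of nil varieties *)

Lemma NILPOTENT_linear k : zero_in (NILPOTENT k) (linear k).
Proof. by apply: COMNULL_zero; rewrite inE. Qed.

Lemma NILPOTENT2_linear j : zero_in (NILPOTENT2 j) (linear j).
Proof. by apply: COMNULL_zero; rewrite !inE eqxx orbT. Qed.

Lemma NILPOTENT2_square j : zero_in (NILPOTENT2 j) (power 2).
Proof. by apply: COMNULL_zero; rewrite !inE eqxx. Qed.

Lemma zero_le V W u : (V <= W)%O -> zero_in W u -> zero_in V u.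
Proof. by move=> /le_members VW H S /VW/H. Qed.

Lemma le_NILPOTENT2 V j : (V <= COM)%O -> zero_in V (power 2) -> zero_in V (linear j) ->
  (V <= NILPOTENT2 j)%O.
Proof.
by move=> VC V2 Vj; apply: le_COMNULL => // w; rewrite !inE => /orP[]/eqP->.
Qed.

Lemma le_NILPOTENT V j : (V <= COM)%O -> zero_in V (linear j) -> (V <= NILPOTENT j)%O.
Proof. by move=> VC Vj; apply: le_COMNULL => // w; rewrite !inE => /eqP->. Qed.

Lemma long_zero V k u : (V <= COM)%O -> zero_in V (linear k) -> 0 < k ->
  k <= size (letters u) -> zero_in V u.
Proof.
move=> VC Vk k0 ku.
apply: (zero_image (f := nth 0 (letters u)) (r := drop k (letters u)) VC) Vk.
by rewrite letters_linear// map_nth_iota0// cat_take_drop.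
Qed.

Lemma not_uniq_perm (s : seq nat) : ~~ uniq s ->
  exists x r, perm_eq s (x :: x :: r).
Proof.
elim: s => //= y s IH; rewrite negb_and negbK => /orP[ys|/IH[x [r p]]].
  by exists y, (rem y s); rewrite perm_cons perm_to_rem.
exists x, (y :: r); apply/permP => a; move/permP/(_ a): p => /= ->; lia.
Qed.

Lemma nonlinear_zero V u : (V <= COM)%O -> zero_in V (power 2) ->
  ~~ uniq (letters u) -> zero_in V u.
Proof.
move=> VC V2 /not_uniq_perm[x [r p]].
exact: (zero_image (f := fun=> x) (r := r) VC) V2.
Qed.

Lemma linear_zero V u k : (V <= COM)%O -> zero_in V u -> uniq (letters u) ->
  size (letters u) <= k -> zero_in V (linear k).
Proof.
move=> VC Vu uu uk; have k0 : 0 < k by exact: leq_trans uk.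
apply: (zero_image (f := index^~ (letters u))
  (r := iota (size (letters u)) (k - size (letters u))) VC) Vu.
rewrite letters_linear//.
have -> : [seq index x (letters u) | x <- letters u] = iota 0 (size (letters u)).
  apply: (@eq_from_nth _ 0) => [|i]; rewrite size_map ?size_iota// => iu.
  by rewrite (nth_map 0)// index_uniq// nth_iota.
by rewrite -{2}[size _]add0n -iotaD subnKC.
Qed.

Lemma power_zero V u k : (V <= COM)%O -> zero_in V u ->
  size (letters u) <= k -> zero_in V (power k).
Proof.
move=> VC Vu uk; have k0 : 0 < k by exact: leq_trans uk.
apply: (zero_image (f := fun=> 0) (r := nseq (k - size (letters u)) 0) VC) Vu.
have -> : [seq 0 | _ <- letters u] = nseq (size (letters u)) 0.
  by elim: (letters u) => //= _ s ->.
by rewrite letters_power// -nseqD subnKC.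
Qed.

Lemma sub_count_perm u v : (forall x, occ x u <= occ x v) ->
  exists r, perm_eq (letters v) (letters u ++ r).
Proof.
by move=> H; have [s /perm_to_subseq[r p] q] :=
  (count_subseqP (letters u) (letters v)).1 H; exists r;
  rewrite (perm_trans p)// perm_cat2r perm_sym.
Qed.

Lemma nilexp_zero_sub V t u v : nilexp V t -> theory (members V) (u, v) ->
  (forall x, occ x u <= occ x v) -> ~~ perm_eq (letters u) (letters v) ->
  zero_in V u.
Proof.
move=> nV T /sub_count_perm[r p] np; apply: (multiple_zero nV T p).
by apply: contra np => /eqP r0; rewrite r0 cats0 in p; rewrite perm_sym.
Qed.

Lemma nilexp_content V t u v : nilexp V t -> theory (members V) (u, v) ->
  ~ zero_in V u -> letters u =i letters v.
Proof.
move=> nV T nu x; apply/idP/idP => xx; apply: contrapT => /negP nx; apply: nu.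
  by apply/(zero_eq (theory_sym T))/(content_zero nV T xx nx).
exact: (content_zero nV (theory_sym T) xx nx).
Qed.

(** Among the nil varieties in which x_0 ... x_(j-1) is not zero there is a least
    one.  The reason is that a nontrivial identity of a nil variety, one side of
    which is linear, makes this side zero: its contents differ, or the other
    side is a proper multiple of it. *)
Lemma NILPOTENT2_min V t j : nilexp V t -> 0 < j -> ~ zero_in V (linear j) ->
  (NILPOTENT2 j.+1 <= V)%O.
Proof.
move=> nV j0 Vj; have [VC _ _] := nV; apply/le_theory => -[u v] T.
have [p|np] := boolP (perm_eq (letters u) (letters v)).
  by have /le_theory := COMNULL_COM [:: power 2; linear j.+1]; apply; apply: COM_sat.
have key u' v' : theory (members V) (u', v') ->
    ~~ perm_eq (letters u') (letters v') -> zero_in (NILPOTENT2 j.+1) u'.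
  move=> T' np'; have [uu|] := boolP (uniq (letters u')); last first.
    by apply: nonlinear_zero (COMNULL_COM _) _; apply: NILPOTENT2_square.
  have [ju|uj] := leqP j.+1 (size (letters u')).
    exact: (long_zero (COMNULL_COM _) (@NILPOTENT2_linear j.+1)) ju.
  case: Vj; have [Vu|nu] := pselect (zero_in V u').
    exact: (linear_zero VC Vu uu).
  have c := nilexp_content nV T' nu.
  apply: (linear_zero VC _ uu uj); apply: (nilexp_zero_sub nV T') => // x.
  by rewrite {1}/occ count_uniq_mem// c -occ_gt0; case: (occ x v').
move=> S QS a; apply: (null_unique (le_COM_comm (COMNULL_COM _) QS)).
  exact: (key _ _ T np S QS).
by apply: (key _ _ (theory_sym T) _ S QS); rewrite perm_sym.
Qed.

Lemma small_perm (s r : seq nat) : size s <= 2 -> size r = size s -> s =i r ->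
  perm_eq s r.
Proof.
case: s => [|x [|y [|//]]]; case: r => [|z [|w [|//]]] //= _ _ H.
  by have := H x; rewrite !inE eqxx => /esym/eqP ->.
have [e|nxy] := eqVneq x y; last first.
  apply: uniq_perm => //=; first by rewrite inE nxy.
  rewrite inE andbT; apply: contra nxy => /eqP zw.
  have := H x; have := H y; rewrite !inE !eqxx orbT zw !orbb.
  by move=> /esym/eqP -> /esym/eqP ->.
subst y; have := H z; have := H w; rewrite !inE !eqxx !orbT !orbb /=.
by move=> /eqP -> /eqP ->.
Qed.

(** Likewise there is a least nil variety in which x^2 is not zero: two words of
    length at most 2 with equal lengths and contents are permutations of each
    other. *)
Lemma NILPOTENT_3_min V t : nilexp V t -> ~ zero_in V (power 2) -> (NILPOTENT 3 <= V)%O.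
Proof.
move=> nV V2; have [VC _ _] := nV; apply/le_theory => -[u v] T.
have [p|np] := boolP (perm_eq (letters u) (letters v)).
  by have /le_theory := COMNULL_COM [:: linear 3]; apply; apply: COM_sat.
have key u' v' : theory (members V) (u', v') ->
    ~~ perm_eq (letters u') (letters v') -> zero_in (NILPOTENT 3) u'.
  move=> T' np'; have [ju|uj] := leqP 3 (size (letters u')).
    exact: (long_zero (COMNULL_COM _) (@NILPOTENT_linear 3)) ju.
  case/negP: np'; apply: small_perm => //.
    exact: (same_length nV T' (k := 2)).
  by apply: (nilexp_content nV T') => Vu; apply/V2/(power_zero VC Vu).
move=> S QS a; apply: (null_unique (le_COM_comm (COMNULL_COM _) QS)).
  exact: (key _ _ T np S QS).
by apply: (key _ _ (theory_sym T) _ S QS); rewrite perm_sym.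
Qed.

(** The subvarieties of U form a chain with j + 1 members.  The recursive form,
    in which V is the greatest proper subvariety, is directly first-order. *)
Fixpoint chain (j : nat) (U : SEM) : Prop :=
  if j is i.+1 then
    exists V : SEM, [/\ (V <= U)%O, ~ (U <= V)%O, chain i V &
      forall Y : SEM, (Y <= U)%O -> ~ (U <= Y)%O -> (Y <= V)%O]
  else (U <= TRIV)%O.

Lemma chain_level i j U V : chain i U -> chain j V -> (U <= V)%O -> i <= j.
Proof.
elim: j i U V => [|j IH] [|i] U V //=.
  move=> [U' [_ nU _ _]] VT UV; case: nU.
  exact: le_trans UV (le_trans VT (TRIV_le _)).
move=> [U' [U'U nU cU HU]] [V' [V'V nV cV HV]] UV.
have [VU|nVU] := pselect (V <= U)%O.
  apply: (IH _ _ _ cU cV); apply: HV; first exact: le_trans U'U UV.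
  by move=> VU'; apply/nU/(le_trans UV VU').
apply: leqW; apply: (IH i.+1 U V') => //; last exact: HV.
by exists U'.
Qed.

Lemma chain_total j V X Y : chain j V -> (X <= V)%O -> (Y <= V)%O ->
  (X <= Y)%O \/ (Y <= X)%O.
Proof.
elim: j V => [|j IH] V /=.
  by move=> VT XV _; left; exact: le_trans XV (le_trans VT (TRIV_le _)).
move=> [V' [_ _ cV HV]] XV YV.
have [VX|nX] := pselect (V <= X)%O; first by right; exact: le_trans YV VX.
have [VY|nY] := pselect (V <= Y)%O; first by left; exact: le_trans XV VY.
by apply: (IH V'); [|exact: HV|exact: HV].
Qed.

Lemma NILPOTENT2_nilexp j : nilexp (NILPOTENT2 j) 2.
Proof. by split => //; [exact: COMNULL_COM|exact: NILPOTENT2_square]. Qed.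

Lemma NILPOTENT_nilexp k : 0 < k -> nilexp (NILPOTENT k) k.
Proof.
move=> k0; split => //; first exact: COMNULL_COM.
apply: (long_zero (COMNULL_COM _) (@NILPOTENT_linear k)) => //.
by rewrite letters_power// size_nseq.
Qed.

Lemma sub_nilexp U V t : (U <= V)%O -> nilexp V t -> nilexp U t.
Proof.
by move=> UV [VC t0 Vt]; split=> //; [exact: le_trans UV VC|exact: zero_le Vt].
Qed.

Lemma chain_NILPOTENT2 j : chain j (NILPOTENT2 j.+1).
Proof.
elim: j => [|j IH] /=.
  apply/le_TRIV => S QS x y.
  have cS := le_COM_comm (COMNULL_COM _) QS.
  have H := @NILPOTENT2_linear 1 S QS.
  exact: (null_unique cS (H (fun=> x) : null_elt x) (H (fun=> y) : null_elt y)).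
exists (NILPOTENT2 j.+1); split=> //.
- apply: (le_NILPOTENT2 (COMNULL_COM _)); first exact: NILPOTENT2_square.
  apply: (long_zero (COMNULL_COM _) (@NILPOTENT2_linear j.+1)) => //.
  by rewrite letters_linear// size_iota.
- move=> le; have := NILPOTENT2_linear_le (ltn0Sn j) (zero_le le (@NILPOTENT2_linear j.+1)).
  by rewrite ltnn.
move=> Y YQ nY; have nYn := sub_nilexp YQ (@NILPOTENT2_nilexp j.+2); have [YC _ Y2] := nYn.
apply: (le_NILPOTENT2 YC Y2); apply: contrapT => Yj; apply/nY.
exact: (NILPOTENT2_min nYn).
Qed.

Lemma NILPOTENT_3_square : ~ zero_in (NILPOTENT 3) (power 2).
Proof.
by move=> /(_ _ (@TRUNC_NILPOTENT 2 false (isT : 0 < 2)) (fun=> (0, 1)))/trunc_null.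
Qed.

Lemma chain_NILPOTENT_3 : chain 3 (NILPOTENT 3).
Proof.
exists (NILPOTENT2 3); split.
- by apply: (le_NILPOTENT (COMNULL_COM _)); apply: NILPOTENT2_linear.
- by move=> /zero_le/(_ (@NILPOTENT2_square 3))/NILPOTENT_3_square.
- exact: (chain_NILPOTENT2 2).
move=> Y YN nY; have nYn := sub_nilexp YN (@NILPOTENT_nilexp 3 isT); have [YC _ _] := nYn.
apply: (le_NILPOTENT2 YC); last by apply: (zero_le YN); apply: NILPOTENT_linear.
by apply: contrapT => /(NILPOTENT_3_min nYn).
Qed.

(** A nil chain is contained in NILPOTENT 3 or satisfies x^2 = 0, because
    NILPOTENT 3 and NILPOTENT2 4 are incomparable; and NILPOTENT 3 has only four
    subvarieties. *)
Lemma chain_square U t j : nilexp U t -> chain j U -> 3 < j ->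
  zero_in U (power 2).
Proof.
move=> nU cU j3; apply: contrapT => U2; have [UC _ _] := nU.
have NU := NILPOTENT_3_min nU U2.
have [U3|nU3] := pselect (zero_in U (linear 3)).
  by have := chain_level cU chain_NILPOTENT_3 (le_NILPOTENT UC U3); rewrite leqNgt j3.
have QU := NILPOTENT2_min nU (isT : 0 < 3) nU3.
case: (chain_total cU NU QU) => le.
  exact/NILPOTENT_3_square/(zero_le le)/NILPOTENT2_square.
by have := NILPOTENT2_linear_le (isT : 0 < 3) (zero_le le (@NILPOTENT_linear 3)).
Qed.

(** * Recovering the exponent of a group variety *)

Definition generated (S : semigroup) : SEM :=
  variety_of (theory [set T | T = S]).

Lemma in_generated S : members (generated S) S.
Proof. by move=> e; apply. Qed.

Lemma generated_theory S e : theory (members (generated S)) e <-> satisfies S e.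
Proof.
split=> [H|H T GT]; first exact/H/in_generated.
by apply: GT => _ ->.
Qed.

Lemma theory_join (V W : SEM) e : theory (members (V `|` W)%O) e <->
  theory (members V) e /\ theory (members W) e.
Proof.
split=> [H|[HV HW] S]; last by apply=> T [/HV|/HW].
have /le_theory VJ : (V <= V `|` W)%O by exact: leUl.
have /le_theory WJ : (W <= V `|` W)%O by exact: leUr.
by split; [exact: VJ|exact: WJ].
Qed.

Section Monogenic.
Variable k : nat.

Lemma capped_bound i : minn i k < k.+1.
Proof. by rewrite ltnS geq_minr. Qed.

Definition capped i : residue k := exist _ (minn i k) (capped_bound i).

(** The nilpotent monogenic semigroup a, a^2, ..., a^(k+1) = 0, where the integer i
    stands for a^(i+1). *)
Definition mono_mul (x y : residue k) : residue k := capped (sval x + sval y).+1.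

Lemma mono_mulA : associative mono_mul.
Proof. by move=> x y z; apply: residue_inj => /=; lia. Qed.

Definition MONO : semigroup := MkSemigroup mono_mulA (inhabits (capped 0)).

Lemma mono_eval (a : nat -> MONO) w :
  sval (word_eval a w) = minn (\sum_(i <- letters w) (sval (a i)).+1).-1 k.
Proof.
case: w => i s; rewrite /word_eval /letters /= big_cons ?addSn /=.
elim: s (a i) => [|j s IH] x /=.
  by rewrite big_nil addn0; apply/esym/minn_idPl; case: x.
by rewrite IH /= big_cons; lia.
Qed.

Lemma mono_null (s : MONO) : sval s = k -> null_elt s.
Proof. by move=> sk y; apply: residue_inj; rewrite /= sk; lia. Qed.

Lemma generated_mono_COM : (generated MONO <= COM)%O.
Proof.
apply/le_theory => e Ce; apply/generated_theory; apply: Ce; apply/in_COM.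
by move=> x y; apply: residue_inj; rewrite /= addnC.
Qed.

Lemma generated_mono_zero w :
  k < size (letters w) -> zero_in (generated MONO) w.
Proof.
move=> kw S GS; apply/null_idP; move: S GS.
apply/generated_theory/null_idP => a; apply: mono_null; rewrite mono_eval.
apply/minn_idPr; rewrite -ltnS prednK; last by rewrite /letters /= big_cons.
apply: leq_trans kw _; rewrite -sum1_size; exact: leq_sum.
Qed.

Lemma generated_mono_nilexp : nilexp (generated MONO) k.+1.
Proof.
split=> //; first exact: generated_mono_COM.
by apply: generated_mono_zero; rewrite letters_power// size_nseq.
Qed.

(** Sending all letters to a recovers the length of a word of length at most k;
    sending one of them to 0 instead tells whether it occurs. *)
Lemma mono_sat u v : 0 < k -> satisfies MONO (u, v) ->
  size (letters u) <= k ->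
  size (letters v) = size (letters u) /\ letters u =i letters v.
Proof.
move=> k0 T uk.
have sv : size (letters v) = size (letters u).
  have := congr1 sval (T (fun=> capped 0)); rewrite !mono_eval /=.
  have E w : \sum_(i <- letters w) (minn 0 k).+1 = size (letters w).
    by rewrite min0n sum1_size.
  by rewrite !E; move: uk; rewrite /letters /=; lia.
split=> //.
have key u' v' x : satisfies MONO (u', v') -> size (letters v') <= k ->
    x \in letters u' -> x \in letters v'.
  move=> T' vk xu; apply: contraTT (vk) => xv; rewrite -ltnNge.
  have := congr1 sval (T' (fun i => if i == x then capped k else capped 0)).
  rewrite !mono_eval /= (big_rem x)//= eqxx /= minnn.
  rewrite (_ : \sum_(i <- letters v') _ = size (letters v')); last first.
    rewrite -sum1_size !big_seq; apply: eq_bigr => i iv.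
    by case: eqP iv xv => [-> ->//|_ _ _]; rewrite /= min0n.
  by move: vk; rewrite /letters /=; lia.
move=> x; apply/idP/idP; first by apply: key => //; rewrite sv.
by apply: key => // a; rewrite T.
Qed.
End Monogenic.

(** For k > 2 the second clause says that the nil variety W satisfies
    x_0 ... x_k = 0, since the chain of k + 2 subvarieties that it excludes can only
    be the one of NILPOTENT2 (k+2).  The nil varieties V below the join of A and W are
    restricted by the identities of W between distinct nonzero words that hold
    in A; the last clause says that such a restriction is present for A and
    absent for some group variety A'.  Nonzero words of W have length at most k,
    and two of them can form such an identity, for a suitable W, exactly when
    the exponent of A is at most k - 2. *)
Definition detects (k : nat) (A : SEM) : Prop :=
  exists W : SEM, [/\ nil_variety W, ~ (exists U : SEM, (U <= W)%O /\ chain k.+1 U) &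
    exists V : SEM, [/\ nil_variety V, ~ (V <= A `|` W)%O &
      exists A' : SEM, group_variety A' /\ (V <= A' `|` W)%O]].

Lemma mono_no_chain k : 2 < k ->
  ~ (exists U : SEM, (U <= generated (MONO k))%O /\ chain k.+1 U).
Proof.
move=> k2 [U [UG cU]]; have nU := sub_nilexp UG (@generated_mono_nilexp k).
have [UC _ _] := nU.
have U2 := chain_square nU cU k2.
have Uk : zero_in U (linear k.+1).
  apply: (zero_le UG); apply: generated_mono_zero.
  by rewrite letters_linear// size_iota.
by have := chain_level cU (chain_NILPOTENT2 k) (le_NILPOTENT2 UC U2 Uk); rewrite ltnn.
Qed.

(** If a letter occurs in both words, its multiplicities lie between 1 and k, so
    their congruence modulo k is an equality. *)
Lemma equal_length_perm k u v : size (letters u) <= k ->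
  size (letters v) = size (letters u) -> letters u =i letters v ->
  (forall i, occ i u = occ i v %[mod k]) -> perm_eq (letters u) (letters v).
Proof.
move=> uk sv c H; apply: occ_perm => i.
have le w : size (letters w) <= k -> occ i w <= k.
  by apply: leq_trans; exact: count_size.
have := le u uk; have := le v; rewrite sv => /(_ uk) vk' uk'.
have := c i; rewrite -!occ_gt0 => c'.
have := H i; case: (ltngtP (occ i u) k) uk' => // [lu _|eu _]; last first.
  rewrite eu modnn; case: (ltngtP (occ i v) k) vk' => // lv _.
  by rewrite modn_small// => E; move: c'; rewrite eu -E ltnn => k0; lia.
rewrite (modn_small lu); case: (ltngtP (occ i v) k) vk' => // [lv _|ev _].
  by rewrite modn_small.
by rewrite ev modnn => E; move: c'; rewrite E ev ltnn; lia.
Qed.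

Definition xa_yb (a b : nat) : word := (0, nseq a.-1 0 ++ nseq b 1).

Lemma letters_xa_yb a b : 0 < a ->
  letters (xa_yb a b) = nseq a 0 ++ nseq b 1.
Proof. by case: a. Qed.

Lemma occ_xa_yb a b i : 0 < a ->
  occ i (xa_yb a b) = (i == 0) * a + (i == 1) * b.
Proof.
move=> a0; rewrite /occ letters_xa_yb// count_cat !count_nseq /=.
by rewrite !(eq_sym i).
Qed.

(** The witnesses are the variety W generated by the nilpotent monogenic
    semigroup of index k + 1, the largest possible V, namely NILPOTENT (k+1), and
    A' = ABEL k.  The words x^(k-1) y and x^(k-1-m) y^(1+m) have the same length k,
    the same content and multiplicities congruent modulo m, so that they are
    identified by ABEL m and by W, but not by V. *)
Lemma detects_small k m : 2 < k -> 0 < m -> m.+1 < k -> detects k (ABEL m).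
Proof.
move=> k2 m0 mk; have k0 : 0 < k by lia.
exists (generated (MONO k)); split.
- by apply/nil_varietyP; exists k.+1; exact: generated_mono_nilexp.
- exact: mono_no_chain.
exists (NILPOTENT k.+1); split.
- by apply/nil_varietyP; exists k.+1; apply: NILPOTENT_nilexp.
- pose u := xa_yb k.-1 1; pose v := xa_yb (k.-1 - m) m.+1.
  have a0 : 0 < k.-1 by lia.
  have b0 : 0 < k.-1 - m by lia.
  have Ek : k.-1 = k.-1 - m + m by lia.
  move=> /le_theory/(_ (u, v)) H.
  have {H} /H : theory (members (ABEL m `|` generated (MONO k))%O) (u, v).
    apply/theory_join; split.
      apply: ABEL_sat => // i; rewrite !occ_xa_yb// {1}Ek.
      case: i => [|[|i]] //=; rewrite ?mul0n ?mul1n ?add0n ?addn0.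
        by rewrite modnDr.
      by rewrite -[m.+1]addn1 modnDl.
    apply/generated_theory => a; apply: residue_inj; rewrite !mono_eval /=.
    rewrite !letters_xa_yb// !big_cat !big_nseq !iter_addn_0 /=.
    by move: (sval (a 0)) (sval (a 1)) => x y; nia.
  move=> /(_ _ (@TRUNC_NILPOTENT k false k0) (fun i => (0, if i == 0 then 2 else 1))) /=.
  have su : size (letters u) = k by rewrite letters_xa_yb// size_cat !size_nseq; lia.
  have sv : size (letters v) = k by rewrite letters_xa_yb// size_cat !size_nseq; lia.
  rewrite !trunc_short ?su ?sv// => /(congr1 snd) /=.
  rewrite !letters_xa_yb// !big_cat !big_nseq /=.
  rewrite !iter_muln_1 !exp1n !muln1 => /eqP; rewrite eqn_exp2l//; lia.
exists (ABEL k); split; first by apply/group_varietyP; exists k.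
apply/le_theory => -[u v] /theory_join[/(ABEL_theory k0) uv /generated_theory T].
  have perm : perm_eq (letters u) (letters v) ->
      theory (members (NILPOTENT k.+1)) (u, v).
    have /le_theory H := COMNULL_COM [:: linear k.+1].
    by move=> p; apply/H/COM_sat.
  have [ku|uk] := leqP (size (letters u)) k.
    by have [sv c] := mono_sat k0 T ku; apply/perm/(equal_length_perm ku).
  have [kv|vk] := leqP (size (letters v)) k.
    apply: perm; rewrite perm_sym.
    have T' : satisfies (MONO k) (v, u) by move=> a; rewrite T.
    by have [sv c] := mono_sat k0 T' kv; apply: (equal_length_perm kv).
  have long := long_zero (COMNULL_COM _) (@NILPOTENT_linear k.+1) (ltn0Sn k).
  move=> S NS a; apply: (null_unique (le_COM_comm (COMNULL_COM _) NS)).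
    exact: (long _ uk).
  exact: (long _ vk).
Qed.

Definition repeat_word (n : nat) (u : word) : word :=
  (u.1, u.2 ++ flatten (nseq n (letters u))).

Lemma occ_repeat n u i : occ i (repeat_word n u) = occ i u * n.+1.
Proof.
rewrite /occ -[letters (repeat_word n u)]/(letters u ++ flatten (nseq n (letters u))).
rewrite count_cat mulnS; congr (_ + _).
elim: n => [|n IH]; first by rewrite muln0.
by rewrite -[flatten _]/(letters u ++ flatten (nseq n (letters u))) count_cat
  IH mulnS.
Qed.

Lemma eval_repeat (S : semigroup) (cS : commutative (@sg_mul S)) (a : nat -> S) n u :
  (inj cS (word_eval a (repeat_word n u)) = inj cS (word_eval a u) *+ n.+1)%R.
Proof.
rewrite inj_eval -[letters (repeat_word n u)]/(letters u ++ flatten (nseq n (letters u))).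
rewrite big_cat mulrS -inj_eval; congr (_ + _)%R.
elim: n => [|n IH]; first by rewrite big_nil.
by rewrite -[flatten _]/(letters u ++ flatten (nseq n (letters u))) big_cat
  -inj_eval IH mulrS.
Qed.

(** Such an s has the null element s^t as a factor. *)
Lemma nilexp_null V t : nilexp V t -> forall (S : semigroup), members V S ->
  forall (cS : commutative (@sg_mul S)) (s : S) r, t <= r ->
  inj cS s = (inj cS s *+ r)%R -> null_elt s.
Proof.
move=> [VC t0 Vt] S VS cS s r tr E.
have := Vt S VS (fun=> s); set z := word_eval _ _ => Hz.
have Ez : inj cS z = (inj cS s *+ t)%R by rewrite /z eval_power.
suff -> : s = z by [].
by apply: (@inj_inj S cS); rewrite E -(subnKC tr) mulrnDr -Ez null_absorb.
Qed.

(** Suppose that u is not zero in W.  Then u and v have the same content and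
    length at most k.  If a letter x occurs more often in v than in u, it occurs
    at least 1 + m >= k times, so that v is a power of x and a proper multiple of
    u, a contradiction; otherwise u is a proper multiple of v, with the same
    conclusion. *)
Lemma zero_of_congruent W k m t u v : nilexp W t -> zero_in W (linear k.+1) ->
  k <= m.+1 -> (forall i, occ i u = occ i v %[mod m]) ->
  theory (members W) (u, v) -> ~~ perm_eq (letters u) (letters v) ->
  zero_in W u.
Proof.
move=> nW Wk km uv T np; apply: contrapT => nWu; have [WC _ _] := nW.
have nWv : ~ zero_in W v by move/(zero_eq (theory_sym T)).
have c := nilexp_content nW T nWu.
have vk : size (letters v) <= k.
  by rewrite leqNgt; apply/negP => /(long_zero WC Wk (ltn0Sn k)).
have [[x lt]|H] := pselect (exists x, occ x u < occ x v); last first.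
  apply: nWv; apply: (nilexp_zero_sub nW (theory_sym T)); last by rewrite perm_sym.
  by move=> x; rewrite leqNgt; apply/negP => lt; apply: H; exists x.
apply: nWu; apply: (nilexp_zero_sub nW T) => // y.
have [->|yx] := eqVneq y x; first exact: ltnW.
have xv : k <= occ x v.
  have xu : 0 < occ x u by rewrite occ_gt0 c -occ_gt0; lia.
  have /eqP := uv x; rewrite eq_sym eqn_mod_dvd; last exact: ltnW.
  by move=> /dvdn_leq; rewrite subn_gt0 lt => /(_ isT); lia.
suff y0 : occ y v = 0.
  have : (0 < occ y u) = (0 < occ y v) by rewrite !occ_gt0 c.
  by rewrite y0; lia.
have : occ x v + occ y v <= size (letters v).
  rewrite -(count_predC (pred1 x) (letters v)) leq_add2l; apply: sub_count => z /=.
  by move=> /eqP ->.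
by lia.
Qed.

(** Every nontrivial identity u = v of ABEL m and W has both sides zero in W.
    A zero word u satisfies u = u^(r+1) in W for every r, and in A' for suitable r; this
    makes u zero in V as well, and likewise v. *)
Lemma detects_large k m : 0 < m -> k <= m.+1 -> ~ detects k (ABEL m).
Proof.
move=> m0 km [W [/nil_varietyP[t nW] nc [V [/nil_varietyP[s nV] VA [A' [gA VA']]]]]].
have [m' m'0 EA'] := (group_varietyP A').1 gA; subst A'; apply: VA.
have [WC _ _] := nW; have [VC s0 _] := nV.
have Wk : zero_in W (linear k.+1).
  apply: contrapT => /(NILPOTENT2_min nW (ltn0Sn k)) QW; apply: nc.
  by exists (NILPOTENT2 k.+2); split=> //; exact: chain_NILPOTENT2.
apply/le_theory => -[u v] /theory_join[/(ABEL_theory m0) uv T].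
have [p|np] := boolP (perm_eq (letters u) (letters v)).
  by have /le_theory := VC; apply; apply: COM_sat.
have key u' v' : (forall i, occ i u' = occ i v' %[mod m]) ->
    theory (members W) (u', v') -> ~~ perm_eq (letters u') (letters v') ->
    zero_in V u'.
  move=> uv' T' np' S VS a; have cS := le_COM_comm VC VS.
  have Wu := zero_of_congruent nW Wk km uv' T' np'.
  apply: (nilexp_null nV VS (cS := cS) (r := (m' * s).+1)).
    by rewrite leqW// leq_pmull.
  (* Raising u' to the power m' s + 1 has no effect in A', of exponent m', nor on
     a zero of W, and it gives zero in V, of nil index s. *)
  move/le_theory: VA' => /(_ (u', repeat_word (m' * s) u')) H.
  rewrite -eval_repeat; congr (inj cS _); apply: H VS a.
  apply/theory_join; split.
    apply: ABEL_sat => // i; rewrite occ_repeat mulnS mulnCA.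
    by rewrite addnC mulnC modnMDl.
  move=> S' WS a; have cS' := le_COM_comm WC WS; apply: (@inj_inj S' cS') => /=.
  by rewrite eval_repeat mulrS null_absorb//; apply: Wu.
move=> S VS a; apply: (null_unique (le_COM_comm VC VS)).
  exact: (key _ _ uv T np S VS).
by apply: (key _ _ _ (theory_sym T) _ S VS); rewrite 1?perm_sym//.
Qed.

(** * Lattice characterizations of COM, SL and ZM *)

Definition LZ : SEM := variety_of [set ((0, [:: 1]), (0, [::]))].
Definition RZ : SEM := variety_of [set ((0, [:: 1]), (1, [::]))].

Lemma in_LZ (S : semigroup) : members LZ S <-> (forall x y : S, sg_mul x y = x).
Proof.
split=> [H x y|H e -> a]; last exact: H.
by have := H _ erefl (fun i => if i == 0 then x else y).
Qed.

Lemma in_RZ (S : semigroup) : members RZ S <-> (forall x y : S, sg_mul x y = y).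
Proof.
split=> [H x y|H e -> a]; last exact: H.
by have := H _ erefl (fun i => if i == 0 then x else y).
Qed.

Lemma le_LZ V : (forall S, members V S -> forall x y : S, sg_mul x y = x) ->
  (V <= LZ)%O.
Proof. by move=> H; apply/le_members => S VS; apply/in_LZ/H. Qed.

Lemma le_RZ V : (forall S, members V S -> forall x y : S, sg_mul x y = y) ->
  (V <= RZ)%O.
Proof. by move=> H; apply/le_members => S VS; apply/in_RZ/H. Qed.

Definition last_letter (w : word) : nat := last w.1 w.2.

Lemma eval_head (S : semigroup) (a : nat -> S) w :
  word_eval a w = a w.1 \/ exists q, word_eval a w = sg_mul (a w.1) q.
Proof.
case: w => i s; rewrite /word_eval /=; elim/last_ind: s => [|s j IH]; first by left.
right; rewrite foldl_rcons; case: IH => [->|[q ->]]; first by exists (a j).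
by exists (sg_mul q (a j)); rewrite sg_mulA.
Qed.

Lemma eval_last (S : semigroup) (a : nat -> S) w :
  word_eval a w = a (last_letter w) \/
  exists q, word_eval a w = sg_mul q (a (last_letter w)).
Proof.
case: w => i s; rewrite /word_eval /last_letter /=.
case: (lastP s) => [|s' j]; first by left.
by right; rewrite foldl_rcons last_rcons; exists (foldl (fun x j => sg_mul x (a j)) (a i) s').
Qed.

Lemma LZ_sat u v : u.1 = v.1 -> theory (members LZ) (u, v).
Proof.
move=> uv S /in_LZ H a /=.
by case: (eval_head a u) => [->|[q ->]]; case: (eval_head a v) => [->|[q' ->]];
  rewrite ?H uv.
Qed.

Lemma RZ_sat u v : last_letter u = last_letter v -> theory (members RZ) (u, v).
Proof.
move=> uv S /in_RZ H a /=.
by case: (eval_last a u) => [->|[q ->]]; case: (eval_last a v) => [->|[q' ->]];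
  rewrite ?H uv.
Qed.

Lemma not_LZ V : ~ (LZ <= V)%O -> exists u v,
  theory (members V) (u, v) /\ u.1 <> v.1.
Proof.
move=> H; apply: contrapT => K; apply/H/le_theory => -[u v] T; apply: LZ_sat.
by apply: contrapT => ne; apply: K; exists u, v.
Qed.

Lemma not_RZ V : ~ (RZ <= V)%O -> exists u v,
  theory (members V) (u, v) /\ last_letter u <> last_letter v.
Proof.
move=> H; apply: contrapT => K; apply/H/le_theory => -[u v] T; apply: RZ_sat.
by apply: contrapT => ne; apply: K; exists u, v.
Qed.

Definition rectangular (V : SEM) := forall S, members V S -> forall x y : S,
  sg_mul x x = x /\ sg_mul (sg_mul x y) x = x.

(** Take an identity with a letter x_0 on one side only, send x_0 to z = y x y and
    the other letters to y.  As y z = z y = z, one side has value z and the other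
    value y. *)
Lemma rectangular_of V : ~ (ZM <= V)%O -> ~ (SL <= V)%O ->
  (forall p, prime p -> ~ (ABEL p <= V)%O) -> rectangular V.
Proof.
move=> nZ /not_SL[u [v [x0 [T xu xv]]]] nA S VS y x.
have idem := idempotent_of nZ nA VS; split=> //.
set z := sg_mul (sg_mul y x) y.
have zy : sg_mul z y = z by rewrite /z -sg_mulA idem.
have yz : sg_mul y z = z by rewrite /z !sg_mulA idem.
have E w : word_eval (fun i => if i == x0 then z else y) w =
    if x0 \in letters w then z else y.
  case: w => i s; rewrite /word_eval /letters /= inE (eq_sym x0).
  elim: s (i == x0) => [|j s IH] b /=; first by rewrite orbF.
  have -> : sg_mul (if b then z else y) (if j == x0 then z else y) =
      if b || (j == x0) then z else y.
    by case: b; case: (j == x0); rewrite ?zy ?yz ?idem.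
  by rewrite IH inE orbA (eq_sym x0).
by have := T S VS (fun i => if i == x0 then z else y); rewrite !E /= xu (negbTE xv).
Qed.

Lemma rect3 V (S : semigroup) : rectangular V -> members V S ->
  forall x q y : S, sg_mul (sg_mul x q) y = sg_mul x y.
Proof.
move=> R VS x q y; have [_ yxy] := R S VS y x; have [_ xx] := R S VS x (sg_mul q y).
by rewrite -{1}yxy !sg_mulA -[X in sg_mul (sg_mul X _) _](sg_mulA x) xx.
Qed.

Lemma rect_RZ V : rectangular V -> ~ (LZ <= V)%O -> (V <= RZ)%O.
Proof.
move=> R /not_LZ[u [v [T uv]]]; apply: le_RZ => S VS x y.
have := T S VS (fun i => if i == u.1 then y else x) => /= /(congr1 (fun t : S => sg_mul t y)).
set a := (fun i => _).
have E w : sg_mul (word_eval a w) y = sg_mul (a w.1) y.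
  by case: (eval_head a w) => [->//|[q ->]]; rewrite (rect3 R VS).
rewrite /= !E /a eqxx; case: eqP => [vu|_]; first by case: uv.
by rewrite (R S VS y y).1 => <-.
Qed.

Lemma rect_LZ V : rectangular V -> ~ (RZ <= V)%O -> (V <= LZ)%O.
Proof.
move=> R /not_RZ[u [v [T uv]]]; apply: le_LZ => S VS x y.
have := T S VS (fun i => if i == last_letter u then x else y) => /= /(congr1 (fun t : S => sg_mul x t)).
set a := (fun i => _).
have E w : sg_mul x (word_eval a w) = sg_mul x (a (last_letter w)).
  by case: (eval_last a w) => [->//|[q ->]]; rewrite sg_mulA (rect3 R VS).
rewrite /= !E /a eqxx; case: eqP => [vu|_]; first by case: uv.
by rewrite (R S VS x x).1 => <-.
Qed.

Lemma le_LZ_RZ V : (V <= LZ)%O -> (V <= RZ)%O -> (V <= TRIV)%O.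
Proof.
move=> /le_members L /le_members R; apply/le_TRIV => S VS x y.
by have /in_LZ/(_ x y) <- := L S VS; have /in_RZ/(_ x y) -> := R S VS.
Qed.

Lemma LZ_nontrivial : ~ (LZ <= TRIV)%O.
Proof.
pose S := @MkSemigroup bool (fun x _ => x) (fun _ _ _ => erefl) (inhabits true).
have LS : members LZ S by apply/in_LZ.
by move=> /le_TRIV/(_ _ LS true false).
Qed.

Lemma RZ_nontrivial : ~ (RZ <= TRIV)%O.
Proof.
pose S := @MkSemigroup bool (fun _ y => y) (fun _ _ _ => erefl) (inhabits true).
have RS : members RZ S by apply/in_RZ.
by move=> /le_TRIV/(_ _ RS true false).
Qed.

(** In particular a is an atom, since b may be any nontrivial subvariety of a. *)
Definition sole_atom (a V : SEM) : Prop :=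
  [/\ ~ (a <= TRIV)%O, (a <= V)%O &
      forall b : SEM, (b <= V)%O -> ~ (b <= TRIV)%O -> (a <= b)%O].

(** This property separates the ABEL p from LZ and RZ, and from SL. *)
Definition extensible_atom (a : SEM) : Prop :=
  exists V : SEM, sole_atom a V /\ ~ (V <= a)%O.

Lemma commutative_atoms V : (V <= COM)%O -> ~ (V <= TRIV)%O ->
  [\/ (ZM <= V)%O, (SL <= V)%O | exists2 p, prime p & (ABEL p <= V)%O].
Proof.
move=> VC nV.
have [?|nZ] := pselect (ZM <= V)%O; first by constructor 1.
have [?|nS] := pselect (SL <= V)%O; first by constructor 2.
constructor 3; have [n n0 E] := (group_varietyP V).1 (And3 VC nZ nS); subst V.
have n1 : 1 < n.
  by rewrite ltn_neqAle n0 andbT; apply/eqP => n1; apply/nV/ABEL_TRIV.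
exists (pdiv n); first exact: pdiv_prime.
by apply/ABEL_dvd => //; exact: pdiv_dvd.
Qed.

Lemma ABEL_sole p : prime p -> sole_atom (ABEL p) (ABEL (p ^ 2)).
Proof.
move=> pp; have p0 := prime_gt0 pp; have p20 : 0 < p ^ 2 by rewrite expn_gt0 p0.
split; first exact/ABEL_nontrivial/prime_gt1.
  by apply/ABEL_dvd => //; rewrite dvdn_exp.
move=> b bp nb; have [d d0 E] := sub_ABEL p20 bp; subst b.
have /(ABEL_dvd d0 p20)/(dvdn_pfactor _ _ pp)[[|i] _ E] := bp.
  by case: nb; apply/ABEL_TRIV; rewrite ?E.
by apply/ABEL_dvd => //; rewrite E dvdn_exp.
Qed.

Lemma ABEL_extensible p : prime p -> extensible_atom (ABEL p).
Proof.
move=> pp; exists (ABEL (p ^ 2)); split; first exact: ABEL_sole.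
have p0 := prime_gt0 pp; have p20 : 0 < p ^ 2 by rewrite expn_gt0 p0.
move=> /(ABEL_dvd p20 p0)/(dvdn_leq p0); rewrite leqNgt.
by rewrite -{1}[p]expn1 ltn_exp2l ?prime_gt1.
Qed.

(** As a lies below every nontrivial subvariety of V, it is commutative if V
    contains ZM, SL or some ABEL p.  Otherwise V consists of rectangular bands.  If
    V contained both LZ and RZ, a would lie below both and be trivial; if one of
    them is missing, V is contained in the other, and so is equal to a. *)
Lemma extensible_commutative a : extensible_atom a -> (a <= COM)%O.
Proof.
move=> [V [[na aV HV] nVa]].
have [ZV|nZ] := pselect (ZM <= V)%O.
  exact: le_trans (HV _ ZV ZM_nontrivial) ZM_COM.
have [SV|nS] := pselect (SL <= V)%O.
  exact: le_trans (HV _ SV SL_nontrivial) SL_COM.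
have [[p pp AV]|nA] := pselect (exists2 p, prime p & (ABEL p <= V)%O).
  exact: le_trans (HV _ AV (ABEL_nontrivial (prime_gt1 pp))) (ABEL_COM p).
have rV : rectangular V.
  by apply: rectangular_of => // p pp AV; apply: nA; exists p.
have ra : rectangular a by move=> S aS; apply: rV; move/le_members: aV; apply.
exfalso; have [LV|nLV] := pselect (LZ <= V)%O; last first.
  apply: nVa; apply: le_trans (rect_RZ rV nLV) _; apply: contrapT => nRa.
  apply: na; apply: le_LZ_RZ; first exact: rect_LZ ra nRa.
  by apply: le_trans aV (rect_RZ rV nLV).
have [RV|nRV] := pselect (RZ <= V)%O; last first.
  apply: nVa; apply: le_trans (rect_LZ rV nRV) _; apply: contrapT => nLa.
  apply: na; apply: le_LZ_RZ; last exact: rect_RZ ra nLa.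
  by apply: le_trans aV (rect_LZ rV nRV).
apply: na; apply: le_LZ_RZ; first exact: HV LV LZ_nontrivial.
exact: HV RV RZ_nontrivial.
Qed.

(** Commutative semigroups form the join of the varieties ABEL p: an identity
    that balances letters modulo all primes is a permutation of letters. *)
Lemma COM_le V : (forall a, extensible_atom a -> (a <= V)%O) -> (COM <= V)%O.
Proof.
move=> H; apply/le_theory => -[u v] T; apply: COM_sat; apply: occ_perm => i.
have [p lt pp] := prime_above (occ i u + occ i v).
have /le_theory/(_ _ T)/(ABEL_theory (prime_gt0 pp))/(_ i) :=
  H _ (ABEL_extensible pp).
by rewrite !modn_small//; lia.
Qed.

Lemma COM_char V : V = COM <->
  (forall a, extensible_atom a -> (a <= V)%O) /\
  (forall W : SEM, (forall a, extensible_atom a -> (a <= W)%O) -> (V <= W)%O).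
Proof.
split=> [->|[HV minV]].
  by split; [exact: extensible_commutative|exact: COM_le].
apply/eqP; rewrite eq_le (COM_le HV) andbT; apply: minV.
exact: extensible_commutative.
Qed.

Lemma nil_NILPOTENT k : 0 < k -> nil_variety (NILPOTENT k).
Proof. by move=> k0; apply/nil_varietyP; exists k; exact: NILPOTENT_nilexp. Qed.

Lemma ZM_square : zero_in ZM (power 2).
Proof.
by move=> S /in_ZM H a y; apply: H.
Qed.

Lemma nil_ZM : nil_variety ZM.
Proof.
by apply/nil_varietyP; exists 2; split=> //; [exact: ZM_COM|exact: ZM_square].
Qed.

Lemma nil_sole_atom V : nil_variety V -> ~ (V <= TRIV)%O -> sole_atom ZM V.
Proof.
by move=> [VC HV] nV; split=> //; [exact: ZM_nontrivial|exact: HV].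
Qed.

Lemma NILPOTENT_nontrivial k : 1 < k -> ~ (NILPOTENT k <= TRIV)%O.
Proof.
case: k => [|[|k]] // _ /le_TRIV/(_ _ (@TRUNC_NILPOTENT k.+1 false (ltn0Sn k))).
by move=> /(_ (0, 0) (0, 1)).
Qed.

Lemma SL_minimal b : (b <= SL)%O -> ~ (b <= TRIV)%O -> (SL <= b)%O.
Proof.
move=> bS nb.
have [Zb|//|[p pp Ab]] := commutative_atoms (le_trans bS SL_COM) nb.
  by case: (SL_no_ZM (le_trans Zb bS)).
have p0 := prime_gt0 pp; case: (ABEL_nontrivial (prime_gt1 pp)).
apply/(ABEL_TRIV p0); have /le_theory H := le_trans Ab bS.
have /H/(ABEL_theory p0)/(_ 0) : theory (members SL) (power 2, power 1).
  by apply: SL_sat => x; rewrite !inE orbb.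
rewrite /occ /= => /eqP; rewrite eqn_mod_dvd// (_ : _ - _ = 1)// dvdn1.
by move/eqP.
Qed.

Lemma SL_sole : sole_atom SL SL.
Proof. by split=> //; [exact: SL_nontrivial|exact: SL_minimal]. Qed.

Lemma SL_only V : (V <= COM)%O -> sole_atom SL V -> (V <= SL)%O.
Proof.
move=> VC [_ SV HV].
have nZ : ~ (ZM <= V)%O.
  move=> ZV; have SZ := HV _ ZV ZM_nontrivial.
  exact/SL_no_ZM/(nil_ZM.2 _ SZ)/SL_nontrivial.
have nA p : prime p -> ~ (ABEL p <= V)%O.
  move=> pp AV; apply: (ABEL_no_SL (prime_gt0 pp)).
  exact/HV/ABEL_nontrivial/prime_gt1.
apply/le_members => S VS; apply/in_SL; split; first exact: le_COM_comm VC VS.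
exact: idempotent_of nZ nA _ VS.
Qed.

(** Among the commutative atoms ZM, SL and ABEL p, only SL is not the sole atom of
    a larger commutative variety: NILPOTENT 3 extends ZM and ABEL (p^2) extends
    ABEL p. *)
Lemma SL_char V : V = SL <-> [/\ (V <= COM)%O, sole_atom V V &
  forall W : SEM, (W <= COM)%O -> sole_atom V W -> (W <= V)%O].
Proof.
split=> [->|[VC VV HV]].
  by split; [exact: SL_COM|exact: SL_sole|exact: SL_only].
have [nV _ minV] := VV.
have [ZV|SV|[p pp AV]] := commutative_atoms VC nV.
- have VZ := minV _ ZV ZM_nontrivial.
  have EV : V = ZM by apply/eqP; rewrite eq_le VZ.
  have : sole_atom ZM (NILPOTENT 3) := nil_sole_atom (@nil_NILPOTENT 3 isT) (@NILPOTENT_nontrivial 3 isT).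
  rewrite -EV => /(HV _ (COMNULL_COM _)); rewrite EV => /zero_le/(_ ZM_square).
  by move/NILPOTENT_3_square.
- have VS := minV _ SV SL_nontrivial.
  by apply/eqP; rewrite eq_le VS.
have VA := minV _ AV (ABEL_nontrivial (prime_gt1 pp)).
have EV : V = ABEL p by apply/eqP; rewrite eq_le VA.
have p0 := prime_gt0 pp; have p20 : 0 < p ^ 2 by rewrite expn_gt0 p0.
have := ABEL_sole pp; rewrite -EV => /(HV _ (ABEL_COM _)); rewrite EV.
move=> /(ABEL_dvd p20 p0)/(dvdn_leq p0); rewrite leqNgt.
by rewrite -{1}[p]expn1 ltn_exp2l ?prime_gt1.
Qed.

(** The commutative varieties whose sole atom is ABEL p are the ABEL (p^i), which
    form a chain, and SL is the sole atom of no variety but itself; whereas ZM is the sole atom of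
    NILPOTENT 4, which contains the incomparable NILPOTENT2 4 and NILPOTENT 3. *)
Lemma ZM_char V : V = ZM <-> exists W : SEM, [/\ (W <= COM)%O, sole_atom V W &
  exists X Y : SEM, [/\ (X <= W)%O, (Y <= W)%O, ~ (X <= Y)%O & ~ (Y <= X)%O]].
Proof.
split=> [->|[W [WC [nV VW HV] [X [Y [XW YW nXY nYX]]]]]].
  exists (NILPOTENT 4); split; first exact: COMNULL_COM.
    by apply: nil_sole_atom; [exact: nil_NILPOTENT|exact: NILPOTENT_nontrivial].
  exists (NILPOTENT2 4), (NILPOTENT 3); split.
  - by apply: (le_NILPOTENT (COMNULL_COM _)); exact: NILPOTENT2_linear.
  - apply: (le_NILPOTENT (COMNULL_COM _)).
    exact: (long_zero (COMNULL_COM _) (@NILPOTENT_linear 3)).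
  - move=> /zero_le/(_ (@NILPOTENT_linear 3)) H.
    by have := NILPOTENT2_linear_le (isT : 0 < 3) H.
  by move=> /zero_le/(_ (@NILPOTENT2_square 4))/NILPOTENT_3_square.
have nW : ~ (W <= TRIV)%O by move=> WT; apply/nV/(le_trans VW WT).
have [ZW|nZ] := pselect (ZM <= W)%O.
  have VZ := HV _ ZW ZM_nontrivial.
  by apply/eqP; rewrite eq_le VZ; exact: nil_ZM.2.
exfalso; have [SW|nS] := pselect (SL <= W)%O.
  have VS := HV _ SW SL_nontrivial.
  have EV : V = SL by apply/eqP; rewrite eq_le VS; exact: SL_minimal.
  have WS : (W <= SL)%O by apply: SL_only => //; rewrite -EV.
  have [XT|nX] := pselect (X <= TRIV)%O; first exact/nXY/(le_trans XT)/TRIV_le.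
  apply: nYX; apply: le_trans (le_trans YW WS) _.
  exact: SL_minimal (le_trans XW WS) nX.
have [n n0 EW] := (group_varietyP W).1 (And3 WC nZ nS); subst W.
have [x x0 EX] := sub_ABEL n0 XW; have [y y0 EY] := sub_ABEL n0 YW; subst X Y.
have n1 : n != 1 by apply/eqP => n1; apply/nW/ABEL_TRIV.
(* All primes dividing n are equal to p, since V is below ABEL q for each of
   them; so the exponents x and y are powers of p. *)
set p := pdiv n.
have pp : prime p by apply: pdiv_prime; rewrite ltn_neqAle eq_sym n1.
have nat z : (ABEL z <= ABEL n)%O -> 0 < z -> p.-nat z.
  move=> zn z0; rewrite /pnat z0; apply/allP => q; rewrite mem_primes.
  move=> /and3P[qp _ qz]; rewrite inE /=; apply/eqP/esym/eqP; apply/negPn/negP => pq.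
  have [q0 p0] := (prime_gt0 qp, prime_gt0 pp).
  have Aq : (ABEL q <= ABEL n)%O by apply: le_trans zn; apply/ABEL_dvd.
  have Ap : (ABEL p <= ABEL n)%O by apply/ABEL_dvd => //; exact: pdiv_dvd.
  have VQ := HV _ Aq (ABEL_nontrivial (prime_gt1 qp)).
  have VP := HV _ Ap (ABEL_nontrivial (prime_gt1 pp)).
  have [v v0 EV] := sub_ABEL p0 VP; subst V.
  apply/nV/(ABEL_TRIV v0)/eqP; rewrite -dvdn1.
  have : v %| gcdn p q by rewrite dvdn_gcd; apply/andP; split; apply/ABEL_dvd.
  by rewrite (eqP (_ : coprime p q))// prime_coprime// dvdn_prime2.
have /p_natP[i Ei] := nat x XW x0; have /p_natP[j Ej] := nat y YW y0.
have [ij|/ltnW ji] := leqP i j.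
  by apply: nXY; apply/ABEL_dvd => //; rewrite Ei Ej dvdn_exp2l.
by apply: nYX; apply/ABEL_dvd => //; rewrite Ei Ej dvdn_exp2l.
Qed.

(** * First-order expressible relations on a lattice *)

Section Expressible.
Variables (d : Order.disp_t) (L : latticeType d).
Implicit Types (P Q : (nat -> L) -> Prop) (i j k : nat).

(** Predicates on assignments, so that variables can be chosen freely; the
    condition on free variables is met at the end, in expr1_definable. *)
Definition expressible P : Prop :=
  exists Phi : lformula, forall e, holds e Phi <-> P e.

Lemma expr_ext P Q : (forall e, P e <-> Q e) -> expressible P -> expressible Q.
Proof. by move=> PQ [F HF]; exists F => e; rewrite HF. Qed.

Lemma expr_le i j : expressible (fun e => e i <= e j)%O.
Proof.
exists (FEq (LJoin (LVar i) (LVar j)) (LVar j)) => e /=.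
by split=> [<-|/join_r //]; exact: leUl.
Qed.

Lemma expr_le_join i j k : expressible (fun e => e i <= e j `|` e k)%O.
Proof.
pose t := LJoin (LVar j) (LVar k).
exists (FEq (LJoin (LVar i) t) t) => e /=.
by split=> [<-|/join_r //]; exact: leUl.
Qed.

Lemma expr_not P : expressible P -> expressible (fun e => ~ P e).
Proof. by move=> [F HF]; exists (FNot F) => e /=; rewrite HF. Qed.

Lemma expr_and P Q : expressible P -> expressible Q ->
  expressible (fun e => P e /\ Q e).
Proof. by move=> [F HF] [G HG]; exists (FAnd F G) => e /=; rewrite HF HG. Qed.

Lemma expr_and3 P Q R : expressible P -> expressible Q -> expressible R ->
  expressible (fun e => [/\ P e, Q e & R e]).
Proof.
move=> eP eQ eR; apply: expr_ext (expr_and (expr_and eP eQ) eR) => e.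
by split=> [[[]]|[]].
Qed.

Lemma expr_imp P Q : expressible P -> expressible Q ->
  expressible (fun e => P e -> Q e).
Proof. by move=> [F HF] [G HG]; exists (FImp F G) => e /=; rewrite HF HG. Qed.

Lemma update_same (e : nat -> L) k b : update e k b k = b.
Proof. by rewrite /update eqxx. Qed.

Lemma update_other (e : nat -> L) k b i : i != k -> update e k b i = e i.
Proof. by rewrite /update => /negbTE ->. Qed.

Definition expr1 (R : L -> Prop) := forall i, expressible (fun e => R (e i)).
Definition expr2 (R : L -> L -> Prop) :=
  forall i j, expressible (fun e => R (e i) (e j)).
Definition expr3 (R : L -> L -> L -> Prop) :=
  forall i j k, expressible (fun e => R (e i) (e j) (e k)).

Lemma expr1_ext (R S : L -> Prop) : (forall a, R a <-> S a) ->
  expr1 R -> expr1 S.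
Proof. by move=> RS eR i; apply: expr_ext (eR i) => e. Qed.

Lemma expr_ex k (Q : (nat -> L) -> L -> Prop) :
    (forall e b c, Q (update e k b) c <-> Q e c) ->
  expressible (fun e => Q e (e k)) -> expressible (fun e => exists b, Q e b).
Proof.
move=> Qk [F HF]; exists (FExists k F) => e /=.
split=> -[b Qb]; exists b.
  by move/HF: Qb; rewrite update_same => /Qk.
by apply/HF; rewrite update_same; apply/Qk.
Qed.

Lemma expr_all k (Q : (nat -> L) -> L -> Prop) :
    (forall e b c, Q (update e k b) c <-> Q e c) ->
  expressible (fun e => Q e (e k)) -> expressible (fun e => forall b, Q e b).
Proof.
move=> Qk eQ.
apply: (expr_ext (P := fun e => ~ exists b, ~ Q e b)) => [e|].
  by split=> [H b|H [b]]; [apply: contrapT => nQ; apply: H; exists b|apply].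
apply/expr_not/(expr_ex (k := k)) => [e b c|]; last exact: expr_not.
by split=> nQ /Qk.
Qed.

Lemma expr1_ex R : expr2 R -> expr1 (fun a => exists b, R a b).
Proof.
move=> eR i; apply: (expr_ex (k := i.+1)) => [e b c|]; last exact: eR.
by rewrite update_other// ltn_eqF.
Qed.

Lemma expr1_all R : expr2 R -> expr1 (fun a => forall b, R a b).
Proof.
move=> eR i; apply: (expr_all (k := i.+1)) => [e b c|]; last exact: eR.
by rewrite update_other// ltn_eqF.
Qed.

Lemma expr2_ex R : expr3 R -> expr2 (fun a b => exists c, R a b c).
Proof.
move=> eR i j; apply: (expr_ex (k := (i + j).+1)) => [e b c|]; last exact: eR.
by rewrite !update_other// ltn_eqF// ltnS (leq_addr, leq_addl).
Qed.

Lemma expr2_all R : expr3 R -> expr2 (fun a b => forall c, R a b c).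
Proof.
move=> eR i j; apply: (expr_all (k := (i + j).+1)) => [e b c|]; last exact: eR.
by rewrite !update_other// ltn_eqF// ltnS (leq_addr, leq_addl).
Qed.

Lemma expr1_const_le c : expr1 (fun a => a = c) -> expr1 (fun a => (a <= c)%O).
Proof.
move=> ec; apply: (expr1_ext (R := fun a => exists b, b = c /\ (a <= b)%O)).
  by move=> a; split=> [[b [-> //]]|ac]; exists c.
by apply: expr1_ex => i j; apply: expr_and; [exact: ec|exact: expr_le].
Qed.

Lemma expr1_const_ge c : expr1 (fun a => a = c) -> expr1 (fun a => (c <= a)%O).
Proof.
move=> ec; apply: (expr1_ext (R := fun a => exists b, b = c /\ (b <= a)%O)).
  by move=> a; split=> [[b [-> //]]|ac]; exists c.
by apply: expr1_ex => i j; apply: expr_and; [exact: ec|exact: expr_le].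
Qed.

Lemma holds_foralls (a : L) i F s : (forall e : nat -> L, holds e F <-> e i = a) ->
  i \notin s -> forall e : nat -> L, holds e (foldr FForall F s) <-> e i = a.
Proof.
move=> HF; elim: s => //= j s IH; rewrite inE negb_or => /andP[ij /IH Hs] e.
split=> [/(_ a)/Hs|ea b]; first by rewrite update_other.
by apply/Hs; rewrite update_other.
Qed.

Lemma free_vars_foralls F s :
  free_vars (foldr FForall F s) = [seq j <- free_vars F | j \notin s].
Proof.
elim: s => [|k s /= ->]; first by rewrite filter_predT.
by rewrite -filter_predI; apply: eq_filter => j; rewrite /= inE negb_or.
Qed.

(** The condition does not depend on the variables other than the 0-th one, so
    that they can be closed universally; conjoining x_0 = x_0 makes sure that x_0 is
    free. *)
Lemma expr1_definable a : expr1 (fun b => b = a) -> @definable d L a.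
Proof.
move=> /(_ 0)[F HF].
pose G := FAnd F (FEq (LVar 0) (LVar 0)).
pose s := [seq j <- free_vars F | j != 0].
exists (foldr FForall G s), 0; split=> [j|].
  rewrite free_vars_foralls mem_filter /= mem_cat !inE !orbb mem_filter.
  by case: eqP => [->|_]; rewrite ?orbT //= orbF andbC; case: (j \in _).
apply: holds_foralls => [e|]; last by rewrite mem_filter.
by rewrite /= HF; split=> [[]|].
Qed.
End Expressible.

Lemma expr_TRIV : expr1 (fun V => (V <= TRIV)%O).
Proof.
apply: (expr1_ext (R := fun V => forall W : SEM, (V <= W)%O)) => [V|].
  by split=> [|VT W]; [exact|exact: le_trans VT (TRIV_le W)].
by apply: expr1_all => i j; exact: expr_le.
Qed.

Lemma expr_sole_atom : expr2 sole_atom.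
Proof.
move=> i j; apply: expr_and3; first by apply: expr_not; exact: expr_TRIV.
  exact: expr_le.
move: i j; apply: (expr2_all (R := fun a V b : SEM =>
  (b <= V)%O -> ~ (b <= TRIV)%O -> (a <= b)%O)) => i j k.
apply: expr_imp; first exact: expr_le.
apply: expr_imp; last exact: expr_le.
by apply: expr_not; exact: expr_TRIV.
Qed.

Lemma expr_extensible : expr1 extensible_atom.
Proof.
apply: expr1_ex => i j; apply: expr_and; first exact: expr_sole_atom.
by apply: expr_not; exact: expr_le.
Qed.

Lemma expr_COM : expr1 (fun V => V = COM).
Proof.
apply: (expr1_ext (fun V => iff_sym (COM_char V))).
have upper : expr1 (fun V => forall a, extensible_atom a -> (a <= V)%O).
  apply: expr1_all => i j; refine (expr_imp _ _); first exact: expr_extensible.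
  exact: expr_le.
move=> i; apply: expr_and; first exact: upper.
move: i; apply: (expr1_all (R := fun V W : SEM =>
  (forall a, extensible_atom a -> (a <= W)%O) -> (V <= W)%O)) => i j.
by apply: expr_imp; [exact: upper|exact: expr_le].
Qed.

Lemma expr_SL : expr1 (fun V => V = SL).
Proof.
apply: (expr1_ext (fun V => iff_sym (SL_char V))) => i.
apply: expr_and3; [exact: (expr1_const_le expr_COM)|exact: expr_sole_atom|].
move: i; apply: (expr1_all (R := fun V W : SEM =>
  (W <= COM)%O -> sole_atom V W -> (W <= V)%O)) => i j.
apply: expr_imp; first exact: (expr1_const_le expr_COM).
by apply: expr_imp; [exact: expr_sole_atom|exact: expr_le].
Qed.

Lemma expr_ZM : expr1 (fun V => V = ZM).
Proof.
apply: (expr1_ext (fun V => iff_sym (ZM_char V))).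
apply: expr1_ex => i j.
apply: expr_and3; [exact: (expr1_const_le expr_COM)|exact: expr_sole_atom|].
move: j; apply: (expr1_ex (R := fun W X : SEM => exists Y : SEM,
  [/\ (X <= W)%O, (Y <= W)%O, ~ (X <= Y)%O & ~ (Y <= X)%O])).
apply: expr2_ex => j k l.
apply: (expr_ext (P := fun e => ((e k <= e j)%O /\ (e l <= e j)%O) /\
   (~ (e k <= e l)%O /\ ~ (e l <= e k)%O))) => [e|].
  by split=> [[[? ?] [? ?]]|[]].
by apply: expr_and; apply: expr_and; (try apply: expr_not); exact: expr_le.
Qed.

Lemma expr_nil_variety : expr1 nil_variety.
Proof.
move=> i; apply: expr_and; first exact: (expr1_const_le expr_COM).
move: i; apply: (expr1_all (R := fun V b : SEM =>
  (b <= V)%O -> ~ (b <= TRIV)%O -> (ZM <= b)%O)) => i j.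
apply: expr_imp; first exact: expr_le.
apply: expr_imp; last exact: (expr1_const_ge expr_ZM).
by apply: expr_not; exact: expr_TRIV.
Qed.

Lemma expr_group_variety : expr1 group_variety.
Proof.
move=> i; apply: expr_and3; first exact: (expr1_const_le expr_COM).
  by apply: expr_not; exact: (expr1_const_ge expr_ZM).
by apply: expr_not; exact: (expr1_const_ge expr_SL).
Qed.

Lemma expr_chain j : expr1 (chain j).
Proof.
elim: j => [|j IH]; first exact: expr_TRIV.
apply: expr1_ex => u v.
apply: (expr_ext (P := fun e => ((e v <= e u)%O /\ ~ (e u <= e v)%O) /\
  (chain j (e v) /\ forall Y : SEM, (Y <= e u)%O -> ~ (e u <= Y)%O -> (Y <= e v)%O))).
  by move=> e; split=> [[[? ?] [? ?]]|[]].
apply: expr_and; first by apply: expr_and; [|apply: expr_not]; exact: expr_le.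
apply: expr_and; first exact: IH.
move: u v; apply: (expr2_all (R := fun U V Y : SEM =>
  (Y <= U)%O -> ~ (U <= Y)%O -> (Y <= V)%O)) => u v y.
apply: expr_imp; first exact: expr_le.
by apply: expr_imp; [apply: expr_not|]; exact: expr_le.
Qed.

Lemma expr_detects k : expr1 (detects k).
Proof.
apply: expr1_ex => a w; apply: expr_and3; first exact: expr_nil_variety.
  apply: expr_not; move: w.
  apply: (expr1_ex (R := fun W U : SEM => (U <= W)%O /\ chain k.+1 U)) => w u.
  by apply: expr_and; [exact: expr_le|exact: expr_chain].
move: a w; apply: (expr2_ex (R := fun A W V : SEM =>
  [/\ nil_variety V, ~ (V <= A `|` W)%O &
    exists A' : SEM, group_variety A' /\ (V <= A' `|` W)%O])) => a w v; apply: expr_and3; first exact: expr_nil_variety.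
  by apply: expr_not; exact: expr_le_join.
have : expr2 (fun V W : SEM =>
    exists A', group_variety A' /\ (V <= A' `|` W)%O).
  apply: expr2_ex => i j b; apply: expr_and; first exact: expr_group_variety.
  exact: expr_le_join.
by apply.
Qed.

(** Groups are cancellative, unlike the null semigroup and the semilattice with
    two elements. *)
Lemma group_variety_of X : abelian_periodic_group_variety X -> group_variety X.
Proof.
move=> hX; split.
- apply/le_members => S /hX[G [f [[g _ gK] fM GC _]]]; apply/in_COM => x y.
  by rewrite -(gK x) -(gK y) -!fM GC.
- move=> /le_members/(_ _ NULL2_ZM)/hX[G [f [[g _ gK] fM _ _]]].
  by have := fM (g true) 1%g; rewrite mulg1 gK.
move=> /le_members/(_ _ AND2_SL)/hX[G [f [[g _ gK] fM _ _]]].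
have := fM (g false) ((g false)^-1 * g true)%g.
by rewrite mulVKg !gK.
Qed.

Theorem theorem4p7 (X : SEM) (hX : abelian_periodic_group_variety X) :
  definable X.
Proof.
have /group_varietyP[n n0 EX] := group_variety_of hX; subst X.
apply: expr1_definable; have [n1|n1] := leqP n 1.
  have -> : n = 1 by apply/eqP; rewrite eqn_leq n1.
  apply: expr1_ext expr_TRIV => V; split=> [VT|->]; last exact/ABEL_TRIV.
  by apply/eqP; rewrite eq_le (le_trans VT (TRIV_le _)) (le_trans _ (TRIV_le V))//;
    apply/ABEL_TRIV.
(* ABEL m is detected by k exactly when m <= k - 2. *)
apply: (expr1_ext (R := fun V => [/\ group_variety V, ~ detects n.+1 V &
  detects n.+2 V])); last first.
  move=> i; apply: expr_and3; [exact: expr_group_variety| |exact: expr_detects].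
  by apply: expr_not; exact: expr_detects.
move=> V; split=> [[/group_varietyP[m m0 ->] nd dd]|->]; last first.
  split; [exact/group_variety_of|exact: detects_large|].
  exact: detects_small.
suff -> : m = n by [].
apply/eqP; rewrite eqn_leq; apply/andP; split; rewrite leqNgt; apply/negP => lt.
  exact: (detects_large m0 _ dd).
by apply/nd/detects_small.
Qed.
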